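(* Let $a,b\in\mathbb{C}\setminus\{0\}$, $c>0$, $c>|a|+|b|+1$, and $0\le\beta<1$. Assume that $$\frac{\Gamma(c)\,\Gamma(c-|a|-|b|)}{\Gamma(|b|)\,\Gamma(c-|b|)}\Bigg[\frac{2|a|}{c-|a|-|b|-1}\sum_{n=0}^{\infty}\binom{-(|a|+1)}{n}\frac{\Gamma(|b|+4+2n)}{\Gamma(c-|a|+3+2n)}\;{}_2F_1(|a|+1,|b|+4+2n;c-|a|+3+2n;-1)$$ $$+\sum_{n=0}^{\infty}\binom{-|a|}{n}\frac{\Gamma(|b|+2n)}{\Gamma(c-|a|+2n)}\;{}_2F_1(|a|,|b|+2n;c-|a|+2n;-1)\Bigg]\le \frac{1}{2(1-\beta)}+1.$$ Then the operator $\mathcal{I}(f)(z)=z\;{}_5F_4\left(a,\tfrac{b}{4},\tfrac{b+1}{4},\tfrac{b+2}{4},\tfrac{b+3}{4};\tfrac{c}{4},\tfrac{c+1}{4},\tfrac{c+2}{4},\tfrac{c+3}{4};z\right)*f(z)$ maps $\mathcal{R}(\beta)$ into $\mathcal{UCV}$.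
   Context: $\mathbb{D}=\{z\in\mathbb{C}:|z|<1\}$. $\mathcal{A}$ is the family of functions $f(z)=z+\sum_{n\ge2}a_nz^n$ analytic in $\mathbb{D}$, and $\mathcal{S}\subset\mathcal{A}$ is the subclass of univalent functions. For $f(z)=z+\sum_{n\ge2} a_nz^n$ and $g(z)=z+\sum_{n\ge2} b_nz^n$ the Hadamard product is $f(z)*g(z)=z+\sum_{n\ge2}a_nb_nz^n$. $\mathcal{UCV}$ (uniformly convex functions) is the class of $f\in\mathcal{S}$ with $\mathrm{Re}\left(1+\frac{(z-\zeta)f''(z)}{f'(z)}\right)>0$ for all $\zeta,z\in\mathbb{D}$; equivalently $\left|\frac{zf''(z)}{f'(z)}\right|<\mathrm{Re}\left(1+\frac{zf''(z)}{f'(z)}\right)$ for all $z\in\mathbb{D}$. For $\beta<1$, $\mathcal{R}(\beta)=\{f\in\mathcal{A}:\ \exists\,\varphi\in\mathbb{R}\text{ with } \mathrm{Re}[e^{i\varphi}(f'(z)-\beta)]>0\text{ for all }z\in\mathbb{D}\}$. Pochhammer symbol: $(x)_0=1$, $(x)_n=x(x+1)\cdots(x+n-1)$; generalized binomial coefficient $\binom{-x}{n}=(-1)^n(x)_n/n!$. ${}_5F_4(a_1,\dots,a_5;b_1,\dots,b_4;z)=\sum_{n\ge0}\frac{(a_1)_n\cdots(a_5)_n}{(b_1)_n\cdots(b_4)_n\,(1)_n}z^n$ for $|z|<1$; ${}_2F_1(p,q;r;z)=\sum_{k\ge0}\frac{(p)_k(q)_k}{(r)_k(1)_k}z^k$ for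 $|z|<1$, extended as usual by analytic continuation to $z=-1$. *)

(* Defs.v *)
From HB Require Import structures.
From mathcomp Require Import all_boot all_order all_algebra.
From mathcomp Require Import complex.
From mathcomp Require Import all_classical all_reals all_analysis.

Set Implicit Arguments.
Unset Strict Implicit.
Unset Printing Implicit Defensive.

Import Order.TTheory GRing.Theory Num.Theory.
Import numFieldNormedType.Exports.

Local Open Scope classical_set_scope.
Local Open Scope ring_scope.

(* The complex numbers over [R], packed as a [numClosedFieldType]: the analysis
   library equips such a field with the topology of its norm and the structure
   of normed module over itself, so that [derivable f z 1] and [derive1] are
   complex differentiability and the complex derivative. *)
Definition Cx (R : realType) : numClosedFieldType := R[i].

Definition toC (R : realType) (x : R) : Cx R := (x%:C)%C.

Definition ReC (R : realType) (z : Cx R) : R := complex.Re z.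

(* The modulus with values in [R]; [`|z|] itself lives in [Cx R]. *)
Definition modC (R : realType) (z : Cx R) : R := ComplexField.Normc.normc z.

Definition expi (R : realType) (phi : R) : Cx R := (cos phi +i* sin phi)%C.

Definition disc (R : realType) : set (Cx R) := [set z | modC z < 1].

Definition taylor_on_disc (R : realType) (f : Cx R -> Cx R) (a : nat -> Cx R) :=
  forall z, disc z -> series (fun n => a n * z ^+ n) @ \oo --> f z.

Definition taylor_coef (R : realType) (f : Cx R -> Cx R) : nat -> Cx R :=
  get [set a | taylor_on_disc f a].

(* Functions are total on [Cx R]; only their values on the disc matter. *)
Definition classA (R : realType) : set (Cx R -> Cx R) :=
  [set f | exists a : nat -> Cx R, [/\ a 0%N = 0, a 1%N = 1 & taylor_on_disc f a]].

Definition classS (R : realType) : set (Cx R -> Cx R) :=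
  [set f | classA f /\
    forall z w, disc z -> disc w -> f z = f w -> z = w].

Definition classUCV (R : realType) : set (Cx R -> Cx R) :=
  [set f | classS f /\
    forall zeta z, disc zeta -> disc z ->
      0 < ReC (1 + (z - zeta) * derive1 (derive1 f) z / derive1 f z)].

Definition classR (R : realType) (beta : R) : set (Cx R -> Cx R) :=
  [set f | classA f /\
    exists phi : R, forall z, disc z ->
      0 < ReC (expi phi * (derive1 f z - toC beta))].

Definition hadamard (R : realType) (f g : Cx R -> Cx R) (z : Cx R) : Cx R :=
  limn (series (fun n => taylor_coef f n * taylor_coef g n * z ^+ n)).

Definition poch (F : fieldType) (x : F) (n : nat) : F :=
  \prod_(0 <= k < n) (x + k%:R).

(* [gbinom (- x) n] is (-1)^n (x)_n / n! *)
Definition gbinom (F : fieldType) (y : F) (n : nat) : F :=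
  (-1) ^+ n * poch (- y) n / n`!%:R.

(* The sum of the series, hence meaningful for [modC z < 1] only. *)
Definition hypser (R : realType) (us ls : seq (Cx R)) (z : Cx R) : Cx R :=
  limn (series (fun n =>
    (\prod_(u <- us) poch u n) / ((\prod_(l <- ls) poch l n) * poch 1 n)
    * z ^+ n)).

Definition slit_plane (R : realType) : set (Cx R) :=
  [set z | forall t : R, 1 <= t -> z <> toC t].

(* [v] is the value at [z] of the (unique) holomorphic function on
   C \ [1, +oo[ that extends the series 2F1(p, q; r; .). *)
Definition is_hyp2F1 (R : realType) (p q r z v : Cx R) :=
  slit_plane z /\
  exists G : Cx R -> Cx R,
    [/\ forall w, slit_plane w -> derivable G w 1,
        forall w, disc w -> G w = hypser [:: p; q] [:: r] w
      & G z = v].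

(* Euler's integral, hence meaningful for [0 < x] only. *)
Definition Gamma (R : realType) (x : R) : R :=
  \int[lebesgue_measure]_(t in `]0, +oo[) (t `^ (x - 1) * expR (- t)).

Definition opI (R : realType) (a b : Cx R) (c : R) (f : Cx R -> Cx R) :
    Cx R -> Cx R :=
  hadamard
    (fun z => z * hypser
       [:: a; b / 4%:R; (b + 1) / 4%:R; (b + 2%:R) / 4%:R; (b + 3%:R) / 4%:R]
       [:: toC (c / 4%:R); toC ((c + 1) / 4%:R); toC ((c + 2%:R) / 4%:R);
           toC ((c + 3%:R) / 4%:R)]
       z)
    f.

(* Main.v *)
Require Import Defs.
From HB Require Import structures.
From mathcomp Require Import all_boot all_order all_algebra.
From mathcomp Require Import complex.
From mathcomp Require Import all_classical all_reals all_analysis.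
From mathcomp Require Import measurable_realfun ftc ring lra.
From mathcomp Require cyclic separable cyclotomic.

Set Implicit Arguments.
Unset Strict Implicit.
Unset Printing Implicit Defensive.

Import Order.TTheory GRing.Theory Num.Theory.
Import numFieldNormedType.Exports.

Local Open Scope classical_set_scope.
Local Open Scope ring_scope.

(* Write [t_k = (|a|)_k (|b|)_(4k) / ((c)_(4k) k!)]. The kernel of the operator
   has coefficients of modulus at most [t_k] (at [z^(k+1)]), a function of
   R(beta) satisfies [n |a_n| <= 2 (1 - beta)] by Caratheodory's inequality, and
   [sum_n n (2n - 1) |A_n| <= 1] (over [n >= 2]) makes a series uniformly convex;
   so it suffices that [sum_k (2k + 1) t_k <= 1 / (2 (1 - beta)) + 1].
   As [(q)_(4k) / (q + p + s)_(4k)] is a moment of the beta weight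
   [t^(q-1) (1-t)^(p+s-1)], the sum of [(p)_k (q)_(4k) / ((q+p+s)_(4k) k!)] is the
   integral of [t^(q-1) (1-t)^(p+s-1) (1-t^4)^(-p)], up to a Gamma factor.
   Factoring [1 - t^4 = (1-t) (1+t) (1+t^2)], expanding [(1+t)^(-p)] gives the
   2F1 at [-1] (as Abel sums), and expanding [(1+t^2)^(-p)] gives the outer
   series of the hypothesis. That series need not converge absolutely, hence a
   second Abel summation, for which a one-sided bound is enough. *)

(** Pochhammer symbols advancing four steps at a time give the kernel [(1-t^4)^(-p)]. Its
    singularity at [t = 1] sits in the factor [(1-t)^(-p)], which cancels against [(1-t)^(p+s-1)]
    and leaves the weight [(1-t)^(s-1)], integrable for [s > 0]; the factors [(1+t)^(-p)] and
    [(1+t^2)^(-p)] are bounded by 1. The hypothesis has two series because [2k + 1] is split. The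
    sum of the [t_k] is the case [p = |a|], [q = |b|], [s = c - |a| - |b|]. Up to a constant,
    [k t_k] is the term of index [k - 1] for [|a| + 1], [|b| + 4], [c + 4]; this lowers [s] by 1,
    whence [c > |a| + |b| + 1]. The obstacle is that neither binomial expansion is dominated up to
    [t = 1]. Each therefore carries a parameter, [x] or [y], below 1. The limit in [x] is an
    equality, obtained by squeezing. In [y] no limit of integrals is taken: for every [y < 1] the
    integral already exceeds a truncation of the wanted sum, because that sum has nonnegative
    terms. *)

(** * The Gamma and beta integrals *)

Section PositiveHalfLine.
Context {R : realType}.
Local Open Scope ereal_scope.
Local Notation mu := (@lebesgue_measure R).
Local Notation D := (`]0%R, +oo[%classic : set R).

(** The right side is a scaled pushforward measure, so uniqueness of Lebesgue measure reduces the
    claim to half-open intervals. *)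
Lemma lebesgue_measure_dilation (a : R) (A : set R) : (0 < a)%R ->
  measurable A -> mu A = a%:E * mu (( *%R a) @^-1` A).
Proof.
move=> a0 mA.
have ma : measurable_fun [set: measurableTypeR R]
  (( *%R a) : _ -> measurableTypeR R) by exact: mulrl_measurable.
pose r : {nonneg R} := NngNum (ltW a0).
rewrite -[RHS]/(pushforward (mscale r mu) (( *%R a) : _ -> measurableTypeR R) A).
apply: lebesgue_measure_unique => //= _ [[x y]] _ <-.
rewrite /pushforward /mscale /=.
have -> : ( *%R a) @^-1` `]x, y] = `](x / a)%R, (y / a)%R]%classic.
  apply/seteqP; split => z /=; rewrite !in_itv/=.
    by rewrite ltr_pdivrMr// ler_pdivlMr// mulrC.
  by rewrite ltr_pdivrMr// ler_pdivlMr// mulrC.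
rewrite !lebesgue_measure_itv/= !lte_fin ltr_pM2r ?invr_gt0//.
case: ifPn => _; last by rewrite mule0.
by rewrite -!EFinB -EFinM; congr (_%:E); field; rewrite gt_eqF.
Qed.

Lemma ge0_integral_dilation (a : R) (f : R -> \bar R) : (0 < a)%R ->
  measurable_fun setT f -> (forall x, 0 <= f x) ->
  \int[mu]_(x in D) f x = \int[mu]_(x in D) (a%:E * f (a * x)%R).
Proof.
move=> a0 mf f0.
have ma : measurable_fun [set: measurableTypeR R]
  (( *%R a) : _ -> measurableTypeR R) by exact: mulrl_measurable.
have mfa : measurable_fun setT (fun x => f (a * x)%R).
  by apply: (measurableT_comp mf); exact: mulrl_measurable.
rewrite ge0_integralZl//; last 2 first.
- exact: measurable_funTS.
- by rewrite lee_fin ltW.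
pose r : {nonneg R} := NngNum (ltW a0).
have preD : ( *%R a) @^-1` D = D.
  by apply/seteqP; split => x /=; rewrite !in_itv/= !andbT pmulr_rgt0.
rewrite -[X in _ * integral _ X _]preD.
rewrite -(@ge0_integral_pushforward _ _ _ (measurableTypeR R) R _ ma mu D f)//; last first.
  exact: measurable_funTS.
rewrite -(ge0_integral_mscale (pushforward mu (( *%R a) : _ -> measurableTypeR R)) _ r)//; last first.
  exact: measurable_funTS.
by apply: eq_measure_integral => //= A mA AS; exact: lebesgue_measure_dilation.
Qed.

(** The indicator of the quadrant turns both sides into iterated integrals over the whole plane. *)
Lemma tonelli_halfline (g : R * R -> R) : measurable_fun setT g ->
  (forall x, 0 <= g x)%R ->
  \int[mu]_(x in D) \int[mu]_(y in D) (g (x, y))%:E =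
  \int[mu]_(y in D) \int[mu]_(x in D) (g (x, y))%:E.
Proof.
move=> mg g0.
pose h (z : R * R) := (\1_(D `*` D) z * g z)%R.
have mh : measurable_fun setT (EFin \o h).
  apply/measurable_EFinP; apply: measurable_funM => //.
  by apply: measurable_indic; exact: measurableX.
have h0 x : 0 <= (EFin \o h) x by rewrite lee_fin mulr_ge0.
have hE x y : h (x, y) = (\1_D x * \1_D y * g (x, y))%R.
  rewrite /h !indicE; congr (_ * _)%R.
  by rewrite -natrM mulnb; congr (_%:R); congr nat_of_bool; rewrite in_setX.
have L x : \int[mu]_y (EFin \o h) (x, y) =
    ((fun x => \int[mu]_(y in D) (g (x, y))%:E) \_ D) x.
  rewrite patchE; case: ifPn => xD.
    rewrite [RHS]integral_mkcond; apply: eq_integral => y _ /=.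
    rewrite hE patchE !indicE xD mul1r; case: ifPn; rewrite ?mul1r ?mul0r //.
  rewrite integral0_eq// => y _ /=.
  by rewrite hE !indicE (negbTE xD) !mul0r.
have L' y : \int[mu]_x (EFin \o h) (x, y) =
    ((fun y => \int[mu]_(x in D) (g (x, y))%:E) \_ D) y.
  rewrite patchE; case: ifPn => xD.
    rewrite [RHS]integral_mkcond; apply: eq_integral => x _ /=.
    rewrite hE patchE !indicE xD mulr1; case: ifPn; rewrite ?mul1r ?mul0r //.
  rewrite integral0_eq// => x _ /=.
  by rewrite hE !indicE (negbTE xD) mulr0 !mul0r.
rewrite integral_mkcond [RHS]integral_mkcond.
transitivity (\int[mu]_x \int[mu]_y (EFin \o h) (x, y)).
  by apply: eq_integral => x _; rewrite L.
transitivity (\int[mu]_y \int[mu]_x (EFin \o h) (x, y)).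
  by apply: (@fubini_tonelli _ _ (measurableTypeR R) (measurableTypeR R) R mu mu (EFin \o h)).
by apply: eq_integral => y _; rewrite L'.
Qed.

Lemma halfline_integralZl (k : \bar R) (f : R -> R) : 0 <= k ->
  measurable_fun setT f -> (forall x, 0 <= f x)%R ->
  \int[mu]_(x in D) (k * (f x)%:E) = k * \int[mu]_(x in D) (f x)%:E.
Proof.
move=> k0 mf f0; apply: ge0_integralZl => //.
- exact/measurable_EFinP/measurable_funTS.
- by move=> x _; rewrite lee_fin.
Qed.

(** Extended-real values let Tonelli and the changes of variables apply before convergence is known;
    finiteness comes with [gammaE_lty]. *)
Definition gammaE (x : R) : \bar R :=
  \int[mu]_(t in D) (t `^ (x - 1) * expR (- t))%:E.

(* The beta integral in the variable [r = (1 - t) / t], so that relating it to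
   Gamma only takes linear changes of variables. *)
Definition betaE (x y : R) : \bar R :=
  \int[mu]_(r in D) (r `^ (y - 1) * (1 + r) `^ (- (x + y)))%:E.

Lemma gammaE_ge0 x : 0 <= gammaE x.
Proof.
by apply: integral_ge0 => t _; rewrite lee_fin mulr_ge0 ?powR_ge0 ?expR_ge0.
Qed.

Lemma measurable_gamma_integrand (l x : R) :
  measurable_fun [set: R] (fun t => t `^ (x - 1) * expR (- (l * t)))%R.
Proof.
apply: measurable_funM => //.
by apply: measurableT_comp => //; apply: measurableT_comp.
Qed.

Lemma gamma_integrand_ge0 (l x t : R) : (0 <= t `^ (x - 1) * expR (- (l * t)))%R.
Proof. by rewrite mulr_ge0 ?powR_ge0 ?expR_ge0. Qed.

Lemma gammaE_dilation (l x : R) : (0 < l)%R ->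
  gammaE x = (l `^ x)%:E * \int[mu]_(t in D) (t `^ (x - 1) * expR (- (l * t)))%:E.
Proof.
move=> l0; rewrite /gammaE (@ge0_integral_dilation l _ l0); last 2 first.
- apply/measurable_EFinP; have := measurable_gamma_integrand 1 x.
  by under eq_fun do rewrite mul1r.
- by move=> t; rewrite lee_fin mulr_ge0 ?powR_ge0 ?expR_ge0.
rewrite -halfline_integralZl; last 3 first.
- by rewrite lee_fin powR_ge0.
- exact: measurable_gamma_integrand.
- exact: gamma_integrand_ge0.
apply: eq_integral => t; rewrite inE/= in_itv/= andbT => t0.
rewrite -!EFinM; congr (_%:E).
have lx : (l `^ x = l * l `^ (x - 1))%R.
  by rewrite -{2}(powRr1 (ltW l0)) -powRD ?(gt_eqF l0) ?implybT// addrC subrK.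
by rewrite powRM ?ltW// lx; ring.
Qed.

(* Tonelli, after the dilation [v = u r] in the inner integral. *)
Lemma gammaE_mul (x y : R) : gammaE x * gammaE y = gammaE (x + y) * betaE x y.
Proof.
pose g (z : R * R) := (z.2 `^ (y - 1) * (z.1 `^ (x + y - 1) * expR (- ((1 + z.2) * z.1))))%R.
have mg : measurable_fun setT g.
  apply: measurable_funM.
    by apply: (measurableT_comp (measurable_powR _)) => //; exact: measurable_snd.
  apply: measurable_funM.
    by apply: (measurableT_comp (measurable_powR _)) => //; exact: measurable_fst.
  apply: measurableT_comp => //; apply: measurableT_comp => //.
  by apply: measurable_funM => //; apply: measurable_funD.
have g0 z : (0 <= g z)%R by rewrite !mulr_ge0 ?powR_ge0 ?expR_ge0.
transitivity (\int[mu]_(u in D) \int[mu]_(r in D) (g (u, r))%:E).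
  rewrite muleC [X in _ * X]/gammaE.
  rewrite -halfline_integralZl; last 3 first.
  - exact: gammaE_ge0.
  - have := measurable_gamma_integrand 1 x.
    by under eq_fun do rewrite mul1r.
  - by move=> t; rewrite mulr_ge0 ?powR_ge0 ?expR_ge0.
  apply: eq_integral => u; rewrite inE/= in_itv/= andbT => u0.
  rewrite (gammaE_dilation _ u0) muleC muleA -EFinM.
  rewrite -halfline_integralZl; last 3 first.
  - by rewrite lee_fin !mulr_ge0 ?powR_ge0 ?expR_ge0.
  - exact: measurable_gamma_integrand.
  - exact: gamma_integrand_ge0.
  apply: eq_integral => r _; rewrite -!EFinM; congr (_%:E); rewrite /g/=.
  have -> : (x + y - 1 = (x - 1) + y)%R by ring.
  rewrite [(u `^ (x - 1 + y))%R]powRD ?(gt_eqF u0) ?implybT//.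
  have -> : (- ((1 + r) * u) = - u + - (u * r))%R by ring.
  by rewrite expRD; ring.
rewrite tonelli_halfline// [betaE x y]/betaE.
rewrite -halfline_integralZl; last 3 first.
- exact: gammaE_ge0.
- apply: measurable_funM => //.
  by apply: (measurableT_comp (measurable_powR _)); exact: measurable_funD.
- by move=> t; rewrite mulr_ge0 ?powR_ge0.
(* For fixed [r], the integral in [u] is that of [gammaE (x + y)] dilated by [1 + r], which produces
   the factor [(1 + r)^(-(x+y))] of [betaE]. *)
apply: eq_integral => r; rewrite inE/= in_itv/= andbT => r0.
have r1 : (0 < 1 + r)%R by rewrite addr_gt0.
rewrite (gammaE_dilation (x + y) r1) muleAC -EFinM.
have -> : ((1 + r) `^ (x + y) * (r `^ (y - 1) * (1 + r) `^ (- (x + y))) = r `^ (y - 1))%R.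
  by rewrite powRN mulrCA divff ?mulr1// gt_eqF// powR_gt0.
rewrite -halfline_integralZl; last 3 first.
- by rewrite lee_fin powR_ge0.
- exact: measurable_gamma_integrand.
- exact: gamma_integrand_ge0.
by apply: eq_integral => u _; rewrite -EFinM.
Qed.
Lemma powRN_cvg0 (x : R) : (0 < x)%R -> ((1 + r) `^ (- x))%R @[r --> +oo%R] --> (0 : R)%R.
Proof.
move=> x0; apply/cvgrPdist_lt => /= e e0.
near=> r.
have r0 : (0 < r)%R by near: r; exact: nbhs_pinfty_gt.
have r1 : (0 < 1 + r)%R by rewrite addr_gt0.
rewrite sub0r normrN ger0_norm ?powR_ge0// powRN.
rewrite invf_plt ?posrE ?powR_gt0//.
have -> : (e^-1 = (e^-1 `^ x^-1) `^ x)%R.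
  by rewrite -powRrM mulVf ?gt_eqF// powRr1// invr_ge0 ltW.
apply: gt0_ltr_powR; rewrite ?nnegrE ?powR_ge0 ?ltW//.
rewrite ltr_wpDl//.
Unshelve. all: by end_near. Qed.

Lemma halfline_FTC (f F : R -> R) (l : R) :
  (forall x, 0 <= x -> 0 <= f x)%R ->
  (forall x : R, 0 <= x -> {for x, continuous f})%R ->
  F x @[x --> +oo%R] --> l ->
  (forall x : R, 0 <= x -> is_derive x 1 F (f x))%R ->
  \int[mu]_(x in D) (f x)%:E = (l - F 0%R)%:E.
Proof.
move=> f0 cf Fl dF.
have cfw : {within `[0%R, +oo[, continuous f}.
  apply: continuous_in_subspaceT => x; rewrite inE/= in_itv/= andbT; exact: cf.
rewrite integral_itv_obnd_cbnd; last first.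
  apply/measurable_EFinP; apply: open_continuous_measurable_fun => //.
  by move=> x; rewrite inE/= in_itv/= andbT => /ltW; exact: cf.
rewrite (@ge0_continuous_FTC2y _ f F 0%R l)//.
- by move=> x /ltW x0; have [] := dF _ x0.
- apply: cvg_at_right_filter; apply: differentiable_continuous; apply/derivable1_diffP.
  by have [] := dF 0%R (lexx _).
- move=> x; rewrite in_itv/= andbT => /ltW x0.
  by have [? <-] := dF _ x0; rewrite derive1E.
Qed.

Lemma gammaE1 : gammaE 1 = 1.
Proof.
rewrite /gammaE.
under eq_integral do rewrite subrr powRr0 mul1r.
have -> : 1 = (0 - (- expR (- 0)))%:E :> \bar R by rewrite oppr0 expR0 opprK add0r.
apply: (@halfline_FTC _ (fun t => - expR (- t))%R).
- by move=> x _; exact: expR_ge0.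
- move=> x _; apply: continuous_comp; first exact: continuousN.
  exact: continuous_expR.
- by rewrite -oppr0; apply: cvgN; exact: cvgr_expR.
- move=> x _; apply: is_derive_eq.
  by rewrite mulrN1 opprK.
Qed.

Lemma betaE1 (x : R) : (0 < x)%R -> betaE x 1 = (x^-1)%:E.
Proof.
move=> x0; rewrite /betaE.
under eq_integral do rewrite subrr powRr0 mul1r.
have dp (p r : R) : (0 <= r)%R ->
   is_derive r 1%R (fun r => (1 + r) `^ p)%R (p * (1 + r) `^ (p - 1))%R.
  move=> r0.
  have r1 : (0 < 1 + r)%R by rewrite ltr_pwDl.
  have := @is_derive1_comp _ (fun y => y `^ p)%R (fun r => 1 + r)%R r _ _ (is_derive1_powR p r1) _.
  move=> /(_ 1%R); rewrite mulr1; apply.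
  have := is_deriveD (is_derive_cst (1%R : R) r 1%R) (is_derive_id r 1%R).
  by rewrite add0r => H; exact: H.
have -> : (x^-1 = 0 - (- (x^-1 * (1 + 0) `^ (- x))))%R.
  by rewrite addr0 powR1 mulr1 sub0r opprK.
apply: (@halfline_FTC _ (fun r => - (x^-1 * (1 + r) `^ (- x)))%R).
- by move=> r _; exact: powR_ge0.
- move=> r r0; apply: differentiable_continuous; apply/derivable1_diffP.
  by have [] := dp (- (x + 1))%R _ r0.
- rewrite -oppr0 -(mulr0 (x^-1)%R); apply: cvgN; apply: cvgMl_tmp.
  exact: powRN_cvg0.
- move=> r r0; have := dp (- x)%R _ r0 => d.
  apply: is_derive_eq.
  by rewrite /GRing.scale/= opprD mulNr mulrN opprK mulrA mulVf ?gt_eqF// mul1r.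
Qed.

(* The case [y = 1] of [gammaE_mul]; no integration by parts is needed. *)
Lemma gammaE_rec (x : R) : (0 < x)%R -> gammaE (x + 1) = x%:E * gammaE x.
Proof.
move=> x0; have := gammaE_mul x 1; rewrite gammaE1 mule1 betaE1// => ->.
by rewrite muleCA -EFinM divff ?mule1// gt_eqF.
Qed.

(** Integer arguments follow from the recursion. For [y >= 1], the bound [t^(y-1) <= 1 + t^n] with
    [n > y - 1] compares with two of them; the recursion from [x + 1] down to [x] covers the
    rest. *)
Lemma gammaE_lty (x : R) : (0 < x)%R -> gammaE x < +oo.
Proof.
have gN n : gammaE n.+1%:R < +oo.
  elim: n => [|n ih]; first by rewrite gammaE1 ltry.
  by rewrite -natr1 gammaE_rec ?ltr0n// lte_mul_pinfty// lee_fin.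
have g1 y : (1 <= y)%R -> gammaE y < +oo.
  move=> y1.
  have y0 : (0 <= y)%R by rewrite (le_trans _ y1).
  pose n := Num.bound y.
  have yn : (y - 1 < n%:R)%R.
    by rewrite (lt_trans _ (archi_boundP y0))// ltrBlDr ltrDl.
  apply: (@le_lt_trans _ _ (gammaE 1 + gammaE n.+1%:R)); last by rewrite lte_add_pinfty// gammaE1 ltry.
  have mg z : measurable_fun D (fun t : R => (t `^ (z - 1) * expR (- t))%:E).
    apply/measurable_EFinP/measurable_funTS; have := measurable_gamma_integrand 1 z.
    by under eq_fun do rewrite mul1r.
  have g0 (z t : R) : 0 <= (t `^ (z - 1) * expR (- t))%:E.
    by rewrite lee_fin mulr_ge0 ?powR_ge0 ?expR_ge0.
  rewrite /gammaE -ge0_integralD//; [|exact: mg|exact: mg].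
  apply: ge0_le_integral => //; first exact: mg.
  - by apply: emeasurable_funD; exact: mg.
  - move=> t; rewrite /= in_itv/= andbT => t0.
    rewrite -EFinD lee_fin -mulrDl ler_wpM2r ?expR_ge0//.
    rewrite subrr powRr0 -natr1 addrK.
    have [t1|/ltW t1] := leP t 1%R.
      apply: (@le_trans _ _ 1%R); last by rewrite lerDl powR_ge0.
      have := @ger_powR _ t; rewrite t0 t1 => /(_ isT 0%R (y - 1)%R).
      by rewrite powRr0; apply; rewrite subr_ge0.
    apply: (@le_trans _ _ (t `^ n%:R))%R; last by rewrite lerDr.
    by apply: ler_powR => //; exact: ltW.
move=> x0; have := g1 (x + 1)%R; rewrite lerDr => /(_ (ltW x0)).
rewrite gammaE_rec// => h.
rewrite -(@lte_pmul2l _ x%:E)//.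
by rewrite mulry gtr0_sg// mul1e.
Qed.

(** At [x + 1] the exponent is positive, so on [[1, 2]] the integrand is at least [exp(-2)]. *)
Lemma gammaE_gt0 (x : R) : (0 < x)%R -> 0 < gammaE x.
Proof.
move=> x0.
have mg z : measurable_fun setT (fun t : R => (t `^ (z - 1) * expR (- t))%:E).
  apply/measurable_EFinP; have := measurable_gamma_integrand 1 z.
  by under eq_fun do rewrite mul1r.
have g0 (z t : R) : 0 <= (t `^ (z - 1) * expR (- t))%:E.
  by rewrite lee_fin mulr_ge0 ?powR_ge0 ?expR_ge0.
suff : 0 < gammaE (x + 1).
  rewrite gammaE_rec//; apply: contraPT; rewrite -leNgt => h.
  have /eqP -> : gammaE x == 0 by rewrite eq_le h gammaE_ge0.
  by rewrite mule0 ltxx.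
apply: (@lt_le_trans _ _ (\int[mu]_(t in `[1%R, 2%R]%classic) (expR (- 2))%:E)).
  rewrite integral_cst//= lebesgue_measure_itv/= lte_fin ltr1n -EFinB -EFinM lte_fin.
  by rewrite mulr_gt0 ?expR_gt0//; lra.
apply: (@le_trans _ _ (\int[mu]_(t in `[1%R, 2%R]%classic) (t `^ (x + 1 - 1) * expR (- t))%:E)).
  apply: ge0_le_integral => //.
  - by apply: measurable_funTS; exact: mg.
  - move=> t; rewrite /= in_itv/= => /andP[t1 t2].
    rewrite lee_fin addrK -[leLHS]mul1r ler_pM ?expR_ge0//.
      have := @ler_powR _ t t1 0%R x; rewrite powRr0; apply; exact: ltW.
    by rewrite ler_expR lerN2.
apply: ge0_subset_integral => //.
- by apply: measurable_funTS; exact: mg.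
- move=> t /=; rewrite !in_itv/= andbT => /andP[t1 _].
  by rewrite (lt_le_trans _ t1).
Qed.

Lemma GammaE (x : R) : (0 < x)%R -> (Gamma x)%:E = gammaE x.
Proof.
move=> x0; rewrite /Gamma /Rintegral fineK// -/(gammaE x).
by rewrite ge0_fin_numE ?gammaE_ge0// gammaE_lty.
Qed.

Lemma Gamma_gt0 (x : R) : (0 < x)%R -> (0 < Gamma x)%R.
Proof. by move=> x0; rewrite -lte_fin GammaE// gammaE_gt0. Qed.

Lemma Gamma_rec (x : R) : (0 < x)%R -> (Gamma (x + 1) = x * Gamma x)%R.
Proof.
move=> x0; apply: EFin_inj; rewrite EFinM !GammaE ?gammaE_rec//.
by rewrite addr_gt0.
Qed.

Lemma betaE_Gamma (x y : R) : (0 < x)%R -> (0 < y)%R ->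
  betaE x y = (Gamma x * Gamma y / Gamma (x + y))%:E.
Proof.
move=> x0 y0; have xy0 : (0 < x + y)%R by rewrite addr_gt0.
have := gammaE_mul x y; rewrite -!GammaE//.
have G0 := Gamma_gt0 xy0.
rewrite EFinM EFinM => ->; rewrite muleAC -EFinM divff ?mul1e// gt_eqF//.
Qed.
End PositiveHalfLine.

(** * The mean against the beta weight *)

Lemma cvgn_le_cst {R : realType} (u : R^nat) (l x : R) (N : nat) :
  u @ \oo --> l -> (forall n, (N <= n)%N -> u n <= x) -> l <= x.
Proof.
move=> ul ux; rewrite -(cvg_lim (@Rhausdorff R) ul); apply: limr_le; first exact: cvgP ul.
by exists N.
Qed.

Lemma cvgn_ge_cst {R : realType} (u : R^nat) (l x : R) (N : nat) :
  u @ \oo --> l -> (forall n, (N <= n)%N -> x <= u n) -> x <= l.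
Proof.
move=> ul ux; rewrite -(cvg_lim (@Rhausdorff R) ul); apply: limr_ge; first exact: cvgP ul.
by exists N.
Qed.

Lemma series_le_lim {R : realType} (M : R^nat) (l : R) n :
  (forall k, 0 <= M k) -> series M @ \oo --> l -> series M n <= l.
Proof.
move=> M0 Ml; apply: (cvgn_ge_cst Ml (N := n)) => m nm.
by apply: nondecreasing_series => // k _.
Qed.

Lemma gt0_powRD {R : realType} (x a b : R) : 0 < x ->
  x `^ (a + b) = x `^ a * x `^ b.
Proof. by move=> x0; rewrite powRD// (gt_eqF x0) implybT. Qed.

Section BetaMean.
Context {R : realType}.
Variables (q s : R).
Hypotheses (q0 : 0 < q) (s0 : 0 < s).
Local Notation mu := (@lebesgue_measure R).
Local Notation D := (`]0, +oo[%classic : set R).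

Let w (r : R) : R := r `^ (s - 1) * (1 + r) `^ (- (q + s)).

Let tau (r : R) : R := (1 + r)^-1.

(* Integral of [h] against [t^(q-1) (1-t)^(s-1)] on [0, 1], with [t = 1/(1+r)]. *)
Definition beta_mean (h : R -> R) : R := \int[mu]_(r in D) (h (tau r) * w r).

(** A class of integrands closed under sums and products. The bound is asked on []0, 1[] only, the
    range of [tau], since powers of [t] are unbounded elsewhere. *)
Definition mbounded01 (h : R -> R) : Prop :=
  measurable_fun setT h /\ exists C : R, forall t : R, 0 < t < 1 -> `|h t| <= C.

Let tau01 (r : R) : 0 < r -> 0 < tau r < 1.
Proof.
move=> r0; have r1 : 0 < 1 + r by rewrite addr_gt0.
by rewrite /tau invr_gt0 r1 invf_lt1// ltrDl.
Qed.

Let tauE (r : R) : 0 < r -> tau r = (1 + r) `^ (-1).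
Proof. by move=> r0; rewrite powR_inv1// ltW// addr_gt0. Qed.

Let w_ge0 r : 0 <= w r. Proof. by rewrite mulr_ge0 ?powR_ge0. Qed.

Let measurable_1D : measurable_fun setT (fun r : R => 1 + r).
Proof. exact: measurable_funD. Qed.

Let measurable_w : measurable_fun setT w.
Proof.
apply: measurable_funM => //.
exact: (measurableT_comp (measurable_powR _)).
Qed.

Let measurable_h (h : R -> R) : measurable_fun setT h -> measurable_fun D (fun r => h (tau r) * w r).
Proof.
move=> mh; have m1 : measurable_fun D (fun r : R => h ((1 + r) `^ (-1))).
  apply: measurable_funTS; apply: (measurableT_comp mh).
  exact: (measurableT_comp (measurable_powR _)).
apply: measurable_funM; last exact: measurable_funTS.
apply: eq_measurable_fun m1 => r; rewrite inE/= in_itv/= andbT => r0.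
by rewrite tauE.
Qed.

Let integrable_w : mu.-integrable D (EFin \o w).
Proof.
apply/integrableP; split; first exact/measurable_EFinP/measurable_funTS.
under eq_integral do rewrite /= ger0_norm//.
by have := betaE_Gamma q0 s0; rewrite /betaE => ->; rewrite ltry.
Qed.

Lemma beta_mean_integrable h : mbounded01 h ->
  mu.-integrable D (EFin \o (fun r => h (tau r) * w r)).
Proof.
move=> [mh [C hC]].
apply: (@le_integrable _ _ _ mu D _ _ (fun r => (C * w r)%:E)) => //.
- by apply/measurable_EFinP; exact: measurable_h.
- move=> r; rewrite /= in_itv/= andbT => r0.
  have C0 : 0 <= C by rewrite (le_trans _ (hC _ (tau01 r0))).
  rewrite lee_fin !normrM ler_wpM2r//.
  by rewrite (le_trans (hC _ (tau01 r0)))// ler_norm.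
- exact: (integrableZl _ C integrable_w).
Qed.

Lemma mbounded01D f g : mbounded01 f -> mbounded01 g -> mbounded01 (fun t => f t + g t).
Proof.
move=> [mf [C fC]] [mg [C' gC]]; split; first exact: measurable_funD.
exists (C + C') => t t01; rewrite (le_trans (ler_normD _ _))// lerD//.
  exact: fC.
exact: gC.
Qed.

Lemma mbounded01M f g : mbounded01 f -> mbounded01 g -> mbounded01 (fun t => f t * g t).
Proof.
move=> [mf [C fC]] [mg [C' gC]]; split; first exact: measurable_funM.
exists (C * C') => t t01; rewrite normrM ler_pM//.
  exact: fC.
exact: gC.
Qed.

Lemma mbounded01_cst k : mbounded01 (fun=> k).
Proof. by split; [exact: measurable_cst|exists `|k|]. Qed.

Lemma mbounded01_exp n : mbounded01 (fun t => t ^+ n).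
Proof.
split; first exact: exprn_measurable.
exists 1 => t /andP[t0 t1]; rewrite normrX (ger0_norm (ltW t0)).
by rewrite exprn_ile1// ltW.
Qed.

Lemma mbounded01_sum (F : nat -> R -> R) n : (forall k, mbounded01 (F k)) ->
  mbounded01 (fun t => \sum_(0 <= k < n) F k t).
Proof.
move=> aF; elim: n => [|n ih].
  by under eq_fun do rewrite big_nil; exact: mbounded01_cst.
by under eq_fun do rewrite big_nat_recr//=; exact: mbounded01D.
Qed.

Lemma beta_meanD f g : mbounded01 f -> mbounded01 g ->
  beta_mean (fun t => f t + g t) = beta_mean f + beta_mean g.
Proof.
move=> af ag; rewrite /beta_mean -RintegralD//; first last.
- exact: beta_mean_integrable.
- exact: beta_mean_integrable.
by apply: eq_Rintegral => r _; rewrite mulrDl.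
Qed.

Lemma beta_meanZ k f : mbounded01 f -> beta_mean (fun t => k * f t) = k * beta_mean f.
Proof.
move=> af; rewrite /beta_mean -RintegralZl//; last exact: beta_mean_integrable.
by apply: eq_Rintegral => r _; rewrite mulrA.
Qed.

Lemma beta_mean_sum (F : nat -> R -> R) n : (forall k, mbounded01 (F k)) ->
  beta_mean (fun t => \sum_(0 <= k < n) F k t) = \sum_(0 <= k < n) beta_mean (F k).
Proof.
move=> aF; elim: n => [|n ih].
  rewrite big_nil -[RHS](mul0r (beta_mean (fun=> 0))) -beta_meanZ; last exact: mbounded01_cst.
  by apply: eq_Rintegral => r _; rewrite big_nil mul0r.
rewrite big_nat_recr//= -ih -beta_meanD//; last exact: mbounded01_sum.
by apply: eq_Rintegral => r _; rewrite big_nat_recr.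
Qed.

Lemma beta_mean_le f g : mbounded01 f -> mbounded01 g ->
  (forall t : R, 0 < t < 1 -> f t <= g t) -> beta_mean f <= beta_mean g.
Proof.
move=> af ag fg; apply: le_Rintegral => //.
- exact: beta_mean_integrable.
- exact: beta_mean_integrable.
- move=> r; rewrite /= in_itv/= andbT => r0.
  by rewrite ler_wpM2r// fg// tau01.
Qed.

Lemma eq_beta_mean f g : (forall t : R, 0 < t < 1 -> f t = g t) ->
  beta_mean f = beta_mean g.
Proof.
move=> fg; apply: eq_Rintegral => r; rewrite inE/= in_itv/= andbT => r0.
by rewrite fg// tau01.
Qed.

Lemma beta_mean_norm f (C : R) : mbounded01 f -> (forall t : R, 0 < t < 1 -> `|f t| <= C) ->
  `|beta_mean f| <= C * beta_mean (fun=> 1).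
Proof.
move=> af fC.
have aC k : k * beta_mean (fun=> 1) = beta_mean (fun=> k).
  by rewrite -beta_meanZ ?mulr1//; exact: mbounded01_cst.
rewrite ler_norml -mulNr !aC; apply/andP; split; apply: beta_mean_le => //.
- exact: mbounded01_cst.
- by move=> t /fC; rewrite ler_norml => /andP[].
- exact: mbounded01_cst.
- by move=> t /fC; rewrite ler_norml => /andP[].
Qed.

(** As [1 - tau r = r / (1 + r)], the two factors merge with the weight into the integrand of
    [betaE (q + n) (s + p)]. *)
Lemma beta_mean_moment n (p : R) : 0 <= p ->
  beta_mean (fun t => t ^+ n * (1 - t) `^ p) =
  Gamma (q + n%:R) * Gamma (s + p) / Gamma (q + n%:R + (s + p)).
Proof.
move=> p0; have qn : 0 < q + n%:R by rewrite ltr_wpDr.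
have sp : 0 < s + p by rewrite ltr_wpDr.
have ah : mbounded01 (fun t => t ^+ n * (1 - t) `^ p).
  apply: mbounded01M; first exact: mbounded01_exp.
  split; first by apply: (measurableT_comp (measurable_powR _)); exact: measurable_funB.
  exists 1 => t /andP[t0 t1]; rewrite ger0_norm ?powR_ge0//.
  by rewrite -[leRHS](powRr0 (1 - t)); apply: ger_powR => //; lra.
apply: EFin_inj; rewrite -betaE_Gamma//.
rewrite /beta_mean /Rintegral fineK; last first.
  exact: (integrable_fin_num _ (beta_mean_integrable ah)).
apply: eq_integral => r; rewrite inE/= in_itv/= andbT => r0; congr (_%:E).
have r1 : 0 < 1 + r by rewrite addr_gt0.
have r1n : (1 + r == 0) = false by rewrite gt_eqF.
have -> : 1 - tau r = r * (1 + r) `^ (-1).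
  by rewrite powR_inv1 ?ltW// /tau; field; rewrite r1n.
rewrite powRM ?powR_ge0 ?ltW// -powRrM.
have -> : tau r ^+ n = (1 + r) `^ (- n%:R) by rewrite powR_invn ?ltW// exprVn.
rewrite /w.
have -> : r `^ (s + p - 1) = r `^ p * r `^ (s - 1).
  by rewrite -gt0_powRD//; congr (_ `^ _); ring.
have -> : (1 + r) `^ (- (q + n%:R + (s + p))) =
   (1 + r) `^ (- n%:R) * (1 + r) `^ (-1 * p) * (1 + r) `^ (- (q + s)).
  by rewrite -!gt0_powRD//; congr (_ `^ _); ring.
by ring.
Qed.

Lemma beta_mean_exp n :
  beta_mean (fun t => t ^+ n) = Gamma (q + n%:R) * Gamma s / Gamma (q + s + n%:R).
Proof.
have := beta_mean_moment n (lexx 0).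
rewrite addr0 addrAC => <-.
by apply: eq_beta_mean => t _; rewrite powRr0 mulr1.
Qed.

(** Weierstrass test: on []0, 1[] the remainder is at most the tail of [M], uniformly in [t], and
    the weight has finite mass. *)
Lemma beta_mean_series (F : nat -> R -> R) (M : nat -> R) g :
  (forall k, mbounded01 (F k)) -> mbounded01 g -> cvgn (series M) ->
  (forall k (t : R), 0 < t < 1 -> `|F k t| <= M k) ->
  (forall t : R, 0 < t < 1 -> series (F ^~ t) @ \oo --> g t) ->
  series (fun k => beta_mean (F k)) @ \oo --> beta_mean g.
Proof.
move=> aF ag cM FM Fg.
have M0 k : 0 <= M k.
  by apply: le_trans (FM k 2^-1 _); rewrite ?normr_ge0//; lra.
have key n (t : R) : 0 < t < 1 -> `|g t - series (F ^~ t) n| <= limn (series M) - series M n.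
  move=> t01.
  have c : (fun m => `|series (F ^~ t) m - series (F ^~ t) n|) @ \oo --> `|g t - series (F ^~ t) n|.
    by apply: cvg_norm; apply: cvgB; [exact: Fg|exact: cvg_cst].
  apply: (cvgn_le_cst c (N := n)) => m nm.
  rewrite sub_series_geq//; apply: (@le_trans _ _ (series M m - series M n)).
    rewrite sub_series_geq// (le_trans (ler_norm_sum _ _ _))//.
    by apply: ler_sum => k _; exact: FM.
  by rewrite lerB// series_le_lim.
apply/cvgrPdist_le => /= e e0.
have L1 : 0 <= beta_mean (fun=> 1).
  rewrite -[leLHS](mul0r (beta_mean (fun=> 0))) -beta_meanZ; last exact: mbounded01_cst.
  by apply: beta_mean_le => [||t _]; [apply: mbounded01M; exact: mbounded01_cst|exact: mbounded01_cst|rewrite mul0r].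
(* The tail gets multiplied by the mass of the weight; adding 1 makes the divisor positive. *)
have /cvgrPdist_le /(_ (e / (beta_mean (fun=> 1) + 1))) := cM.
have L2 : 0 < beta_mean (fun=> 1) + 1 by rewrite ltr_wpDl.
move=> /(_ (divr_gt0 e0 L2)); apply: filterS => n h.
have -> : series (fun k => beta_mean (F k)) n = beta_mean (fun t => series (F ^~ t) n).
  by rewrite /series/= beta_mean_sum.
have aS : mbounded01 (fun t => series (F ^~ t) n) by exact: mbounded01_sum.
have aN : mbounded01 (fun t => -1 * series (F ^~ t) n) by apply: mbounded01M => //; exact: mbounded01_cst.
have -> : beta_mean g - beta_mean (fun t => series (F ^~ t) n) =
    beta_mean (fun t => g t + -1 * series (F ^~ t) n).
  by rewrite beta_meanD// beta_meanZ// mulN1r.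
apply: (le_trans (beta_mean_norm (C := e / (beta_mean (fun=> 1) + 1)) _ _)).
- exact: mbounded01D.
- move=> t t01; rewrite mulN1r; apply: (le_trans (key n t t01)).
  by apply: le_trans h; exact: ler_norm.
- rewrite mulrAC ler_pdivrMr// ler_pM2l// lerDl//.
Qed.
End BetaMean.

(** * Pochhammer symbols and the binomial series *)

Lemma pochS (F : fieldType) (x : F) n : poch x n.+1 = poch x n * (x + n%:R).
Proof. by rewrite /poch big_nat_recr. Qed.

Lemma poch0 (F : fieldType) (x : F) : poch x 0 = 1.
Proof. by rewrite /poch big_nil. Qed.

Lemma poch_recl (F : fieldType) (x : F) n : poch x n.+1 = x * poch (x + 1) n.
Proof.
elim: n => [|n ih]; first by rewrite pochS !poch0 mulr1 mul1r addr0.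
by rewrite pochS ih pochS -natr1 -mulrA; congr (_ * (_ * _)); ring.
Qed.

Lemma poch_gt0 (F : numFieldType) (x : F) n : 0 < x -> 0 < poch x n.
Proof.
move=> x0; elim: n => [|n ih]; first by rewrite poch0.
by rewrite pochS mulr_gt0// ltr_wpDr.
Qed.

Lemma fact_gt0r (F : numFieldType) n : 0 < n`!%:R :> F.
Proof. by rewrite ltr0n fact_gt0. Qed.
#[local] Hint Resolve fact_gt0r : core.

Lemma fact_neq0 (F : numFieldType) n : n`!%:R != 0 :> F.
Proof. by rewrite gt_eqF. Qed.

Lemma Gamma_poch (R : realType) (x : R) n : 0 < x ->
  Gamma (x + n%:R) = poch x n * Gamma x.
Proof.
move=> x0; elim: n => [|n ih]; first by rewrite addr0 poch0 mul1r.
have xn : 0 < x + n%:R by rewrite ltr_wpDr.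
have -> : x + n.+1%:R = x + n%:R + 1 by rewrite -natr1 addrA.
by rewrite (Gamma_rec xn) ih pochS mulrA (mulrC (x + _)).
Qed.

Lemma pochD (F : fieldType) (x : F) m n : poch x (m + n) = poch x m * poch (x + m%:R) n.
Proof.
elim: n => [|n ih]; first by rewrite addn0 poch0 mulr1.
by rewrite addnS !pochS ih natrD -mulrA addrA.
Qed.

Section BinomialSeries.
Context {R : realType}.
Implicit Types p x z : R.

Definition bincoef p n : R := poch p n / n`!%:R.

Lemma bincoef_gt0 p n : 0 < p -> 0 < bincoef p n.
Proof. by move=> p0; rewrite divr_gt0// poch_gt0. Qed.

Lemma bincoefS p n : bincoef p n.+1 = bincoef p n * ((p + n%:R) / n.+1%:R).
Proof.
rewrite /bincoef pochS factS natrM invfM; ring.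
Qed.

Lemma bincoef_recl p n : n.+1%:R * bincoef p n.+1 = p * bincoef (p + 1) n.
Proof.
rewrite /bincoef poch_recl factS natrM; field.
by rewrite fact_neq0/= nat1r pnatr_eq0.
Qed.

Lemma gbinomE p n : gbinom (- p) n = (-1) ^+ n * bincoef p n.
Proof. by rewrite /gbinom opprK mulrA. Qed.

(** For [x < y < 1] the quotients of the terms by [y^n] eventually decrease, so they are bounded and
    the geometric series of ratio [y] dominates. *)
Lemma is_cvg_bincoef p x : 0 < p -> 0 < x -> x < 1 ->
  cvgn (series (fun n => bincoef p n * x ^+ n)).
Proof.
move=> p0 x0 x1.
have [y [xy y1 y0]] : exists y : R, [/\ x < y, y < 1 & 0 < y].
  by exists ((1 + x) / 2); split; lra.
pose t n := bincoef p n * x ^+ n / y ^+ n.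
have t0 n : 0 <= t n by rewrite /t ltW// divr_gt0 ?exprn_gt0// mulr_gt0 ?exprn_gt0 ?bincoef_gt0.
(* From this index on, [(p + n) x <= (n + 1) y], that is, the ratio of consecutive [t n] is at most
   1. *)
pose K := Num.bound (p * x / (y - x)).
have tK n : (K <= n)%N -> t n.+1 <= t n.
  move=> Kn.
  have -> : t n.+1 = t n * ((p + n%:R) / n.+1%:R * (x / y)).
    rewrite /t bincoefS !exprS invfM; ring.
  apply: ler_piMr => //; rewrite mulf_div ler_pdivrMr ?mulr_gt0// mul1r.
  have : p * x / (y - x) <= n%:R.
    apply: (le_trans (ltW (archi_boundP _))); last by rewrite ler_nat.
    by rewrite divr_ge0 ?mulr_ge0// ltW// subr_gt0.
  rewrite ler_pdivrMr ?subr_gt0// -natr1 => h.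
  by nra.
pose C := \sum_(0 <= j < K.+1) t j.
have tC n : t n <= C.
  elim: n => [|n ih].
    by rewrite /C big_nat_recl//= lerDl sumr_ge0.
  have [Kn|nK] := leqP K n; first exact: le_trans (tK _ Kn) ih.
  have nK' : (n.+1 < K.+1)%N by [].
  by rewrite /C big_mkord (bigD1 (Ordinal nK'))//= lerDl sumr_ge0.
apply: (@series_le_cvg _ _ (geometric C y)).
- by move=> n; rewrite mulr_ge0 ?exprn_ge0 ?ltW// bincoef_gt0.
- by move=> n; rewrite geometric_ge0 ?(ltW y0)// (le_trans (t0 0%N)).
- move=> n /=; have := tC n; rewrite /t ler_pdivrMr ?exprn_gt0//.
- by apply: is_cvg_geometric_series; rewrite gtr0_norm.
Qed.

Lemma is_derive0_eq (f : R -> R) (a b : R) : a <= b ->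
  (forall x, x \in `[a, b] -> is_derive x 1 f 0) -> f a = f b.
Proof.
move=> ab df.
have dab (x : R) : x \in `]a, b[ -> is_derive x 1 f ((fun=> 0) x).
  by move=> xab; apply: df; exact: subset_itv_oo_cc xab.
have fc : {within `[a, b], continuous f}.
  by apply: derivable_within_continuous => x /df [].
have [d _ /eqP] := MVT_segment ab dab fc.
by rewrite mul0r subr_eq0 => /eqP.
Qed.

(* The sum [g] satisfies [(1 + x) g' = - p g], so [(1 + x)^p g] is constant. *)
Lemma binseries p z : 0 < p -> `|z| < 1 ->
  series (fun n => (-1) ^+ n * bincoef p n * z ^+ n) @ \oo --> (1 + z) `^ (- p).
Proof.
move=> p0 z1.
pose c r n : R := (-1) ^+ n * bincoef r n.
have cN r n : 0 < r -> `|c r n| = bincoef r n.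
  by move=> r0; rewrite normrM normrX normrN1 expr1n mul1r gtr0_norm ?bincoef_gt0.
have cv0 (r y : R) : 0 < r -> 0 < y -> y < 1 -> cvgn (pseries (c r) y).
  move=> r0 y0 y1; apply: normed_cvg; rewrite /normed_series_of /=.
  under eq_fun do rewrite normrM cN// normrX (gtr0_norm y0).
  exact: is_cvg_bincoef.
have cv (r x : R) : 0 < r -> `|x| < 1 -> cvgn (pseries (c r) x).
  move=> r0 x1; have x0 := normr_ge0 x.
  apply: (@is_cvg_pseries_inside _ _ ((1 + `|x|) / 2)); first by apply: cv0 => //; lra.
  rewrite [ltRHS]gtr0_norm; lra.
(* Differentiation stays in the family [c r] up to a factor, so convergence of the first and second
   derived series reduces to [cv]. *)
have dc r : pseries_diffs (c r) = (fun n => - r * c (r + 1) n).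
  apply/funext => n; rewrite /pseries_diffs /c exprS.
  have := bincoef_recl r n => h.
  by rewrite mulrCA h; ring.
have cvZ (f : R^nat) (k x : R) : cvgn (pseries f x) -> cvgn (pseries (fun n => k * f n) x).
  move=> /(@is_cvg_seriesZ _ _ k).
  have -> // : series (k *: [sequence f i * x ^+ i]_i) = pseries (fun n => k * f n) x.
  by congr series; apply/funext => n; exact: mulrA.
have cvd (r x : R) : 0 < r -> `|x| < 1 -> cvgn (pseries (pseries_diffs (c r)) x).
  by move=> r0 x1; rewrite dc; apply/cvZ/cv => //; rewrite addr_gt0.
have cvdd (r x : R) : 0 < r -> `|x| < 1 ->
    cvgn (pseries (pseries_diffs (pseries_diffs (c r))) x).
  move=> r0 x1; have -> : pseries_diffs (pseries_diffs (c r)) =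
      (fun n => - r * pseries_diffs (c (r + 1)) n).
    by apply/funext => n; rewrite dc /pseries_diffs mulrCA.
  by apply/cvZ/cvd => //; rewrite addr_gt0.
pose g (x : R) := limn (pseries (c p) x).
pose g' (x : R) := limn (pseries (pseries_diffs (c p)) x).
have dg (x : R) : `|x| < 1 -> is_derive x 1 g (g' x).
  move=> x1; have x0 := normr_ge0 x.
  have K1 : `|(1 + `|x|) / 2| < 1 by rewrite gtr0_norm; lra.
  apply: (@pseries_snd_diffs _ _ ((1 + `|x|) / 2)); [exact: cv|exact: cvd|exact: cvdd|].
  by rewrite [ltRHS]gtr0_norm; lra.
have ode (x : R) : `|x| < 1 -> (1 + x) * g' x = - p * g x.
  move=> x1.
  have h1 : pseries (pseries_diffs (c p)) x @ \oo --> g' x by exact: cvd.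
  have h2 := pseries_diffs_equiv (cvd _ _ p0 x1).
  have h3 : pseries (c p) x @ \oo --> g x by exact: cv.
  have h4 : (fun n => pseries (pseries_diffs (c p)) x n +
      x * series (fun i => i%:R * c p i * x ^+ i.-1) n) @ \oo --> g' x + x * g' x.
    by apply: cvgD => //; exact: cvgMl_tmp.
  have h5 : (fun n => - p * pseries (c p) x n) @ \oo --> - p * g x by exact: cvgMl_tmp.
  (* The partial sums already agree term by term: [(i+1) c_(i+1) + i c_i = - p c_i]. The form of the
     derivative in [h2] has exponent [i - 1], so multiplying by [x] aligns the exponents. *)
  rewrite mulrDl mul1r; apply: (cvg_unique (@Rhausdorff R) h4).
  apply: cvg_trans h5; apply: near_eq_cvg; near=> n.
  rewrite /pseries /series/= !mulr_sumr -big_split/=; apply: eq_bigr => i _.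
  rewrite /pseries_diffs /c exprS bincoefS.
  have -> : x * (i%:R * ((-1) ^+ i * bincoef p i) * x ^+ i.-1) =
     i%:R * ((-1) ^+ i * bincoef p i) * x ^+ i.
    by case: i => [|i]; [rewrite !mul0r mulr0|rewrite [x ^+ i.+1]exprS /=; ring].
  field.
  by rewrite nat1r pnatr_eq0.
pose phi (x : R) := (1 + x) `^ p * g x.
have dphi (x : R) : `|x| < 1 -> is_derive x 1 phi 0.
  move=> x1; have x1' : 0 < 1 + x by move: x1; rewrite ltr_norml; lra.
  have d1 : is_derive x 1 (fun x => 1 + x : R) 1.
    by have := is_deriveD (is_derive_cst (1 : R) x 1) (is_derive_id x 1); rewrite add0r => H; exact: H.
  have d2 := is_derive1_comp (is_derive1_powR p x1') d1.
  have d3 := is_deriveM d2 (dg x x1).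
  apply: is_derive_eq d3 _.
  rewrite /GRing.scale/= mulr1.
  have -> : (1 + x) `^ p = (1 + x) `^ (p - 1) * (1 + x).
    by rewrite -[X in _ = _ * X](powRr1 (ltW x1')) -gt0_powRD// subrK.
  rewrite -mulrA ode//; ring.
have phi0 : phi 0 = 1.
  rewrite /phi addr0 powR1 mul1r /g /pseries.
  apply: cvg_lim => //; apply: cvg_near_cst; exists 1%N => //= n n0.
  rewrite /series/= (big_cat_nat (n := 1))//= big_nat1 big1_seq ?addr0.
    by rewrite /c /bincoef poch0 fact0 !expr0 !mul1r mulr1 invr1.
  by move=> [|i]; rewrite mem_index_iota// => _; rewrite exprS mul0r mulr0.
have phiz : phi z = 1.
  rewrite -phi0.
  have cst (a b : R) : -1 < a -> a <= b -> b < 1 -> phi a = phi b.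
    move=> a1 ab b1.
    apply: is_derive0_eq => // x; rewrite in_itv/= => /andP[ax xb]; apply: dphi.
    by rewrite ltr_norml; apply/andP; split; lra.
  move: z1; rewrite ltr_norml => /andP[z1 z2].
  by have [z0|/ltW z0] := leP 0 z; [apply/esym/cst|apply/cst] => //; lra.
have -> : (1 + z) `^ (- p) = g z.
  rewrite powRN; have z1' : 0 < 1 + z by move: z1; rewrite ltr_norml; lra.
  apply: (@mulfI _ ((1 + z) `^ p)); first by rewrite gt_eqF// powR_gt0.
  by rewrite divff ?gt_eqF ?powR_gt0// -phiz.
exact: cv.
Unshelve. all: by end_near. Qed.
End BinomialSeries.

(** * Abel summation and the hypergeometric sum *)

(** If [Z > S], compare with the level [S + e] halfway between. Late partial sums lie below it, so
    after summation by parts their contribution is nonpositive, and the finitely many early ones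
    carry the factor [1 - y], which is small near 1. *)
Lemma abel_ge (R : realType) (u : R^nat) (S Z : R) :
  series u @ \oo --> S ->
  (forall y A : R, 0 < y -> y < 1 ->
     series (fun n => u n * y ^+ n) @ \oo --> A -> Z <= A) ->
  Z <= S.
Proof.
move=> uS hZ; rewrite leNgt; apply/negP => SZ.
pose e := (Z - S) / 2.
have e0 : 0 < e by rewrite /e; lra.
have [N _ hN] : \forall n \near \oo, `|S - series u n| <= e.
  by move/cvgrPdist_le: uS => /(_ _ e0).
pose t n := series u n - (S + e).
have tN n : (N <= n)%N -> t n <= 0.
  by move=> /hN /=; rewrite /t ler_norml => /andP[]; lra.
pose C := \sum_(0 <= k < N) `|t k.+1|.
have C0 : 0 <= C by apply: sumr_ge0.
have [y [y0 y1 yC]] : exists y : R, [/\ 0 < y, y < 1 & (1 - y) * C < e].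
  have eC : 0 < e + C by rewrite ltr_pwDl.
  (* Chosen so that [(1 - y) C = e C / (2 (e + C)) < e]. *)
  exists (1 - e / (2 * (e + C))); split.
  - by rewrite subr_gt0 ltr_pdivrMr ?mulr_gt0// mul1r; lra.
  - by rewrite ltrBlDr ltrDl divr_gt0// mulr_gt0.
  - rewrite opprB addrCA subrr addr0 mulrAC ltr_pdivrMr ?mulr_gt0//.
    by rewrite ltr_pM2l//; lra.
have uy : cvgn (series (fun n => u n * y ^+ n)).
  apply: (@is_cvg_pseries_inside _ u 1); last by rewrite normr1 gtr0_norm.
  apply/cvg_ex; exists S.
  have -> // : pseries u 1 = series u.
  by congr series; apply/funext => n; rewrite /= expr1n mulr1.
have := hZ y _ y0 y1 uy; apply/negP; rewrite -ltNge.
(* Summation by parts, centred at [S + e] so that only the sign of the late [t k] matters. *)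
have id n : series (fun n => u n * y ^+ n) n - (S + e) =
    t n * y ^+ n + (1 - y) * \sum_(0 <= k < n) t k.+1 * y ^+ k.
  elim: n => [|n ih].
    by rewrite /t /series/= !big_nil expr0 mulr1 mulr0 addr0.
  rewrite {1}/series/= !big_nat_recr//=.
  have -> : \sum_(0 <= k < n) u k * y ^+ k = t n * y ^+ n +
     (1 - y) * (\sum_(0 <= k < n) t k.+1 * y ^+ k) + (S + e).
    by rewrite -ih subrK.
  have -> : t n.+1 = t n + u n.
    by rewrite /t /series/= big_nat_recr//=; ring.
  by rewrite exprS; ring.
suff h : limn (series (fun n => u n * y ^+ n)) <= S + e + (1 - y) * C.
  by rewrite (le_lt_trans h)//; move: yC; rewrite /e; lra.
apply: (cvgn_le_cst uy (N := N)) => n Nn.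
rewrite -lerBlDl id.
apply: (@le_trans _ _ (0 + (1 - y) * C)); last by rewrite add0r.
apply: lerD.
  by rewrite mulr_le0_ge0 ?tN// exprn_ge0// ltW.
apply: ler_wpM2l; first by rewrite subr_ge0 ltW.
rewrite (big_cat_nat (n := N))//= /C -[leRHS]addr0; apply: lerD.
  apply: ler_sum => k _; apply: (le_trans (ler_norm _)).
  rewrite normrM ler_piMr// normrX gtr0_norm// exprn_ile1// ltW//.
rewrite big_seq_cond; apply: sumr_le0 => k; rewrite mem_index_iota andbT => /andP[Nk _].
by rewrite mulr_le0_ge0 ?exprn_ge0 ?(ltW y0)// tN// leqW.
Qed.
Lemma cvg_seriesMl (K : numFieldType) (u : nat -> K) (k l : K) :
  series u @ \oo --> l -> series (fun n => k * u n) @ \oo --> k * l.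
Proof.
have -> : series (fun n => k * u n) = (fun n => k * series u n).
  by apply/funext => n; rewrite /series/= mulr_sumr.
exact: cvgMl_tmp.
Qed.
Arguments cvg_seriesMl {K u} k {l}.

Lemma eq_cvg_series (K : numFieldType) (u v : nat -> K) (l : K) : u =1 v ->
  series u @ \oo --> l -> series v @ \oo --> l.
Proof. by move=> /funext ->. Qed.

Lemma cvg_series_unique (K : numFieldType) (u v : nat -> K) (l l' : K) : u =1 v ->
  series u @ \oo --> l -> series v @ \oo --> l' -> l = l'.
Proof. by move=> /funext ->; apply: cvg_unique; exact: norm_hausdorff. Qed.

Section HypergeometricSum.
Context {R : realType}.
Variables (p q s : R).
Hypotheses (p0 : 0 < p) (q0 : 0 < q) (s0 : 0 < s).
Local Notation L := (beta_mean q s).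

(** Serves both factors: [kern x t] deforms [(1+t)^(-p)] and [kern y (t ^+ 2)] deforms
    [(1+t^2)^(-p)]; the true integrand has both parameters equal to 1. *)
Let kern (x t : R) : R := (1 + x * t) `^ (- p).

Let kern01 (x t : R) : 0 <= x -> 0 < t -> 0 < 1 + x * t.
Proof. by move=> x0 t0; rewrite ltr_pwDl// mulr_ge0// ltW. Qed.

Let kern_le1 (x t : R) : 0 <= x -> 0 < t -> kern x t <= 1.
Proof.
move=> x0 t0; rewrite /kern powRN invf_le1 ?powR_gt0 ?kern01//.
have := @ler_powR _ (1 + x * t); rewrite lerDl mulr_ge0 ?(ltW t0)// => /(_ isT 0 p (ltW p0)).
by rewrite powRr0.
Qed.

Let kern_anti (x x' t : R) : 0 <= x -> x <= x' -> 0 < t -> kern x' t <= kern x t.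
Proof.
move=> x0 xx t0; have x'0 : 0 <= x' by exact: le_trans xx.
have h := kern01 x0 t0; have h' := kern01 x'0 t0.
rewrite /kern !powRN lef_pV2 ?posrE ?powR_gt0//.
apply: ge0_ler_powR; rewrite ?nnegrE; [exact: ltW|exact: ltW|exact: ltW|].
by rewrite lerD2l ler_wpM2r// ltW.
Qed.

Let mbounded01_kern (x : R) : 0 <= x -> mbounded01 (kern x).
Proof.
move=> x0; split.
  apply: (measurableT_comp (measurable_powR _)); apply: measurable_funD => //.
exists 1 => t /andP[t0 _]; rewrite ger0_norm ?powR_ge0//; exact: kern_le1.
Qed.

Let mbounded01_kern2 (x : R) : 0 <= x -> mbounded01 (fun t => kern x (t ^+ 2)).
Proof.
move=> x0; split.
  apply: (measurableT_comp (measurable_powR _)); apply: measurable_funD => //.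
  apply: measurable_funM => //.
exists 1 => t /andP[t0 _]; rewrite ger0_norm ?powR_ge0//; apply: kern_le1 => //.
by rewrite exprn_gt0.
Qed.

Let normb k : `|(-1) ^+ k * bincoef p k| = bincoef p k.
Proof. by rewrite normrM normrX normrN1 expr1n mul1r gtr0_norm ?bincoef_gt0. Qed.

Let m j : R := L (fun t => t ^+ j).
Let mE j : m j = Gamma (q + j%:R) * Gamma s / Gamma (q + s + j%:R).
Proof. exact: beta_mean_exp. Qed.

(** For [x < 1] this is, up to the moment [m (2 * n)], the 2F1 series at [-x]; its value at [x = 1]
    thus replaces the 2F1 at [-1]. *)
Let J n (x : R) : R := L (fun t => t ^+ (2 * n) * kern x t).

Let J_series n (x : R) : 0 < x -> x < 1 ->
  series (fun k => (-1) ^+ k * bincoef p k * x ^+ k * m (2 * n + k)) @ \oo --> J n x.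
Proof.
move=> x0 x1.
pose F k t : R := (-1) ^+ k * bincoef p k * x ^+ k * t ^+ (2 * n + k).
have aF k : mbounded01 (F k) by apply: mbounded01M; [exact: mbounded01_cst|exact: mbounded01_exp].
have -> : (fun k => (-1) ^+ k * bincoef p k * x ^+ k * m (2 * n + k)) = (fun k => L (F k)).
  by apply/funext => k; rewrite /F beta_meanZ//; exact: mbounded01_exp.
apply: (@beta_mean_series _ q s q0 s0 F (fun k => bincoef p k * x ^+ k)) => //.
- by apply: mbounded01M; [exact: mbounded01_exp|exact/mbounded01_kern/ltW].
- exact: is_cvg_bincoef.
- move=> k t /andP[t0 t1].
  rewrite /F normrM normrM normb !normrX (gtr0_norm x0) (gtr0_norm t0).
  have := ltW t0; have := ltW t1; have := ltW x0; have := ltW (bincoef_gt0 k p0) => b0 x0' t1' t0'.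
  by apply: ler_piMr; [exact: mulr_ge0 b0 (exprn_ge0 _ x0')|exact: exprn_ile1].
- move=> t /andP[t0 t1].
  have xt : `|x * t| < 1 by rewrite gtr0_norm ?mulr_gt0// mulr_ilt1 ?ltW.
  apply: (eq_cvg_series _ (cvg_seriesMl (t ^+ (2 * n)) (binseries p0 xt))) => k.
  by rewrite /F exprMn exprD; ring.
Qed.

(** From [x (1 + t) <= 1 + x t <= 1 + t], raised to the power [-p]. The outer bounds agree at
    [x = 1], which squeezes [J n x]. *)
Let J1_le n (x : R) : 0 < x -> x <= 1 -> J n 1 <= J n x /\ J n x <= x `^ (- p) * J n 1.
Proof.
move=> x0 x1.
have a1 : mbounded01 (fun t => t ^+ (2 * n) * kern 1 t) by apply: mbounded01M; [exact: mbounded01_exp|exact: mbounded01_kern].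
have ax : mbounded01 (fun t => t ^+ (2 * n) * kern x t) by apply: mbounded01M; [exact: mbounded01_exp|exact/mbounded01_kern/ltW].
split.
  apply: beta_mean_le => // t /andP[t0 t1].
  by rewrite ler_wpM2l ?exprn_ge0 ?(ltW t0)// kern_anti// ltW.
rewrite /J -beta_meanZ//; apply: beta_mean_le => //; first exact: mbounded01M (mbounded01_cst _) a1.
move=> t /andP[t0 t1]; rewrite mulrCA ler_wpM2l ?exprn_ge0 ?(ltW t0)//.
have h := kern01 (ltW x0) t0; have h1 : 0 < 1 + t by rewrite addr_gt0.
have h2 : 0 < x * (1 + t) by rewrite mulr_gt0.
rewrite /kern mul1r -powRM ?(ltW x0) ?(ltW h1)//.
rewrite !powRN lef_pV2 ?posrE ?powR_gt0//.
apply: ge0_ler_powR; rewrite ?nnegrE; [exact: ltW|exact: ltW|exact: ltW|].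
by rewrite mulrDr mulr1 lerD2r.
Qed.

Let J_cvg n : J n x @[x --> 1^'-] --> J n 1.
Proof.
have c1 : x `^ (- p) * J n 1 @[x --> (1:R)^'-] --> J n 1.
  rewrite -[X in _ --> X]mul1r; apply: cvgMr_tmp.
  have [d _] := is_derive1_powR (- p) (ltr01 : 0 < 1 :> R).
  move: d => /derivable1_diffP /differentiable_continuous /cvg_at_left_filter.
  by rewrite powR1.
apply: (squeeze_cvgr _ (cvg_cst (J n 1)) c1).
near=> x.
apply/andP; apply: J1_le.
  by near: x; apply: nbhs_left_gt.
by apply: ltW; near: x; exact: nbhs_left_lt.
Unshelve. all: by end_near. Qed.

Let I_series (y : R) : 0 < y -> y < 1 ->
  series (fun n => (-1) ^+ n * bincoef p n * J n 1 * y ^+ n) @ \oo -->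
  L (fun t => kern 1 t * kern y (t ^+ 2)).
Proof.
move=> y0 y1.
pose F n t : R := (-1) ^+ n * bincoef p n * y ^+ n * (t ^+ (2 * n) * kern 1 t).
have aF0 n : mbounded01 (fun t => t ^+ (2 * n) * kern 1 t) by apply: mbounded01M; [exact: mbounded01_exp|exact: mbounded01_kern].
have aF n : mbounded01 (F n) by apply: mbounded01M; [exact: mbounded01_cst|].
have -> : (fun n => (-1) ^+ n * bincoef p n * J n 1 * y ^+ n) = (fun n => L (F n)).
  by apply/funext => n; rewrite /F beta_meanZ// /J mulrAC.
apply: (@beta_mean_series _ q s q0 s0 F (fun k => bincoef p k * y ^+ k)) => //.
- by apply: mbounded01M; [exact: mbounded01_kern|exact/mbounded01_kern2/ltW].
- exact: is_cvg_bincoef.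
- move=> k t /andP[t0 t1].
  have := ltW t0; have := ltW t1; have := ltW y0; have := ltW (bincoef_gt0 k p0) => b0 y0' t1' t0'.
  rewrite /F normrM normrM normb normrX (gtr0_norm y0).
  apply: ler_piMr; first exact: mulr_ge0 b0 (exprn_ge0 _ y0').
  rewrite ger0_norm; last by rewrite mulr_ge0 ?exprn_ge0 ?powR_ge0.
  by apply: mulr_ile1; rewrite ?exprn_ge0 ?powR_ge0 ?exprn_ile1// kern_le1.
- move=> t /andP[t0 t1].
  have t2 : 0 < t ^+ 2 by rewrite exprn_gt0.
  have xt : `|y * t ^+ 2| < 1.
    by rewrite gtr0_norm ?mulr_gt0// mulr_ilt1 ?ltW// exprn_ilt1 ?ltW.
  apply: (eq_cvg_series _ (cvg_seriesMl (kern 1 t) (binseries p0 xt))) => k.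
  by rewrite /F exprMn exprM; ring.
Qed.

(** Lowering [y] from 1 only increases the kernel, and at [y = 1] the product is
    [(1-t)^p (1-t^4)^(-p)], whose binomial expansion has nonnegative terms and so dominates its
    truncations. *)
Let kern_lower (y t : R) M : 0 < y -> y < 1 -> 0 < t < 1 ->
  \sum_(0 <= k < M) bincoef p k * (t ^+ (4 * k) * (1 - t) `^ p) <=
  kern 1 t * kern y (t ^+ 2).
Proof.
move=> y0 y1 /andP[t0 t1].
have t2 : 0 < t ^+ 2 by rewrite exprn_gt0.
have t4 : 0 < t ^+ 4 by rewrite exprn_gt0.
have t41 : t ^+ 4 < 1 by rewrite exprn_ilt1 ?ltW.
apply: (@le_trans _ _ (kern 1 t * kern 1 (t ^+ 2))); last first.
  by rewrite ler_wpM2l ?powR_ge0// kern_anti// ltW.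
have -> : kern 1 t * kern 1 (t ^+ 2) = (1 - t) `^ p * (1 + (- t ^+ 4)) `^ (- p).
  have -> : 1 + (- t ^+ 4) = (1 - t) * ((1 + t) * (1 + t ^+ 2)) by ring.
  rewrite [in RHS]powRM; last 2 first.
  - by rewrite subr_ge0 ltW.
  - by rewrite mulr_ge0// addr_ge0// ltW.
  rewrite mulrA [(1 - t) `^ (- p)]powRN divff ?mul1r; last by rewrite gt_eqF// powR_gt0// subr_gt0.
  by rewrite powRM ?addr_ge0 ?(ltW t0) ?(ltW t2)// /kern !mul1r.
have z1 : `|- t ^+ 4| < 1 by rewrite normrN gtr0_norm.
have bs : series (fun k => bincoef p k * t ^+ (4 * k)) @ \oo --> (1 + (- t ^+ 4)) `^ (- p).
  apply: (eq_cvg_series _ (binseries p0 z1)) => k.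
  by rewrite (exprNn (t ^+ 4)) mulrCA !mulrA -exprMn mulrNN mul1r expr1n mul1r exprM.
have -> : \sum_(0 <= k < M) bincoef p k * (t ^+ (4 * k) * (1 - t) `^ p) =
    (1 - t) `^ p * series (fun k => bincoef p k * t ^+ (4 * k)) M.
  by rewrite /series/= mulr_sumr; apply: eq_bigr => k _; ring.
apply: ler_wpM2l; first exact: powR_ge0.
apply: series_le_lim => // k.
exact: mulr_ge0 (ltW (bincoef_gt0 k p0)) (exprn_ge0 _ (ltW t0)).
Qed.

Let m_shift n k : m (2 * n + k) =
  m (2 * n) * (poch (q + (2 * n)%:R) k / poch (q + s + (2 * n)%:R) k).
Proof.
have qj : 0 < q + (2 * n)%:R by rewrite ltr_wpDr.
have qsj : 0 < q + s + (2 * n)%:R by rewrite ltr_wpDr// addr_gt0.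
have e1 : Gamma (q + (2 * n + k)%:R) = poch (q + (2 * n)%:R) k * Gamma (q + (2 * n)%:R).
  by rewrite natrD addrA; exact: Gamma_poch.
have e2 : Gamma (q + s + (2 * n + k)%:R) = poch (q + s + (2 * n)%:R) k * Gamma (q + s + (2 * n)%:R).
  by rewrite natrD addrA; exact: Gamma_poch.
rewrite !mE e1 e2 invfM.
move: (Gamma _) (Gamma s) (Gamma _) => G1 G2 G3; ring.
Qed.

(** [F n] enters as an Abel limit of the 2F1 series at [-1], the form that the analytic continuation
    provides. Truncating at [M] means that the left side is the mean of a finite sum. *)
Lemma hypergeometric_sum_le (F : nat -> R) (S : R) (M : nat) :
  (forall n, exists H : R -> R,
    (forall x : R, 0 < x -> x < 1 ->
      series (fun k => poch p k * poch (q + (2 * n)%:R) k /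
        (poch (q + s + (2 * n)%:R) k * k`!%:R) * (- x) ^+ k) @ \oo --> H x) /\
    H x @[x --> 1^'-] --> F n) ->
  series (fun n => gbinom (- p) n *
    (Gamma (q + (2 * n)%:R) / Gamma (q + s + (2 * n)%:R)) * F n) @ \oo --> S ->
  \sum_(0 <= k < M) bincoef p k * (poch q (4 * k) / poch (q + s + p) (4 * k)) <=
  Gamma (q + s + p) * Gamma s / (Gamma q * Gamma (s + p)) * S.
Proof.
move=> hF hS.
have JF n : J n 1 = m (2 * n) * F n.
  have [H [Hs HF]] := hF n.
  have HJ (x : R) : 0 < x -> x < 1 -> J n x = m (2 * n) * H x.
    move=> x0 x1.
    apply: (cvg_series_unique _ (J_series (n := n) x0 x1) (cvg_seriesMl (m (2 * n)) (Hs x x0 x1))) => k.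
    rewrite m_shift (exprNn x) /bincoef invfM; move: (poch _ k) (poch _ k)^-1 => P Q; ring.
  have HF' : m (2 * n) * H x @[x --> 1^'-] --> m (2 * n) * F n by exact: cvgMl_tmp.
  have HJ' : J n x @[x --> 1^'-] --> m (2 * n) * F n.
    apply: cvg_trans HF'; apply: near_eq_cvg; near=> x.
    by rewrite -HJ//.
  exact: (cvg_unique (@Rhausdorff R) (J_cvg (n := n)) HJ').
(* The assumed series is the outer expansion at [y = 1], where it cannot be exchanged with the
   integral directly; [abel_ge] moves the comparison to [y < 1]. *)
have uS : series (fun n => (-1) ^+ n * bincoef p n * J n 1) @ \oo --> Gamma s * S.
  apply: (eq_cvg_series _ (cvg_seriesMl (Gamma s) hS)) => n.
  rewrite JF mE gbinomE.
  move: (Gamma _) (Gamma s) (Gamma _) => G1 G2 G3; ring.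
pose Z := L (fun t => \sum_(0 <= k < M) bincoef p k * (t ^+ (4 * k) * (1 - t) `^ p)).
have am k : mbounded01 (fun t : R => t ^+ (4 * k) * (1 - t) `^ p).
  apply: mbounded01M; first exact: mbounded01_exp.
  split; first by apply: (measurableT_comp (measurable_powR _)); exact: measurable_funB.
  exists 1 => t /andP[t0 t1]; rewrite ger0_norm ?powR_ge0//.
  by rewrite -[leRHS](powRr0 (1 - t)); apply: ger_powR; rewrite ?(ltW p0)//; lra.
have az k : mbounded01 (fun t : R => bincoef p k * (t ^+ (4 * k) * (1 - t) `^ p)).
  by apply: mbounded01M => //; exact: mbounded01_cst.
have ZS : Z <= Gamma s * S.
  apply: (abel_ge uS) => y A y0 y1 hA.
  rewrite (cvg_unique (@Rhausdorff R) hA (I_series y0 y1)).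
  apply: beta_mean_le => //.
  - exact: mbounded01_sum.
  - by apply: mbounded01M; [exact: mbounded01_kern|exact/mbounded01_kern2/ltW].
  - by move=> t t01; exact: kern_lower.
have c0 : 0 < q + s + p by rewrite !addr_gt0.
have sp : 0 < s + p by rewrite addr_gt0.
have ZE : Z = Gamma q * Gamma (s + p) / Gamma (q + s + p) *
    \sum_(0 <= k < M) bincoef p k * (poch q (4 * k) / poch (q + s + p) (4 * k)).
  rewrite /Z beta_mean_sum// mulr_sumr; apply: eq_bigr => k _.
  rewrite beta_meanZ// (beta_mean_moment q0 s0 _ (ltW p0)).
  have -> : q + (4 * k)%:R + (s + p) = q + s + p + (4 * k)%:R by ring.
  rewrite (Gamma_poch _ q0) (Gamma_poch _ c0) invfM.
  move: (Gamma q) (Gamma (s + p)) (Gamma (q + s + p)) => G1 G2 G3; ring.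
have Gq := Gamma_gt0 q0; have Gsp := Gamma_gt0 sp; have Gc := Gamma_gt0 c0.
move: ZS; rewrite ZE; move: (\sum_(0 <= k < M) _) => T.
move: (Gamma q) (Gamma (s + p)) (Gamma (q + s + p)) (Gamma s) Gq Gsp Gc => G1 G2 G3 G4 h1 h2 h3 h.
have -> : G3 * G4 / (G1 * G2) * S = (G3 / (G1 * G2)) * (G4 * S) by ring.
have -> : T = G3 / (G1 * G2) * (G1 * G2 / G3 * T).
  by field; rewrite !gt_eqF.
by rewrite ler_pM2l ?divr_gt0 ?mulr_gt0.
Unshelve. all: by end_near. Qed.
End HypergeometricSum.

(** * Moduli and series of complex numbers *)

Section ComplexModulus.
Context {R : realType}.
Implicit Types z w : Cx R.

Lemma normCxE z : `|z| = toC (modC z). Proof. by []. Qed.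

Lemma toC_le (x y : R) : (toC x <= toC y) = (x <= y).
Proof. exact: lecR. Qed.

Lemma toC_lt (x y : R) : (toC x < toC y) = (x < y).
Proof. exact: ltcR. Qed.

Lemma toC_inj : injective (@toC R).
Proof. exact: complexI. Qed.

Lemma toCD (x y : R) : toC (x + y) = toC x + toC y.
Proof. exact: rmorphD. Qed.

Lemma toCB (x y : R) : toC (x - y) = toC x - toC y.
Proof. exact: rmorphB. Qed.

Lemma toCN (x : R) : toC (- x) = - toC x.
Proof. exact: rmorphN. Qed.

Lemma toCM (x y : R) : toC (x * y) = toC x * toC y.
Proof. exact: rmorphM. Qed.

Lemma toCV (x : R) : toC (x^-1) = (toC x)^-1.
Proof. exact: fmorphV. Qed.

Lemma toCX (x : R) n : toC (x ^+ n) = toC x ^+ n.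
Proof. exact: rmorphXn. Qed.

Lemma toC_nat n : toC (n%:R : R) = n%:R.
Proof. exact: rmorph_nat. Qed.

Lemma toC1 : toC (1 : R) = 1. Proof. by []. Qed.

Lemma toC0 : toC (0 : R) = 0. Proof. by []. Qed.

Lemma toC_sum (I : Type) (r : seq I) (F : I -> R) :
  toC (\sum_(i <- r) F i) = \sum_(i <- r) toC (F i).
Proof. exact: rmorph_sum. Qed.

Lemma modC_ge0 z : 0 <= modC z.
Proof. by rewrite -toC_le toC0 -normCxE normr_ge0. Qed.

Lemma modCM z w : modC (z * w) = modC z * modC w.
Proof. by apply: toC_inj; rewrite toCM -!normCxE normrM. Qed.

Lemma modCX z n : modC (z ^+ n) = modC z ^+ n.
Proof. by apply: toC_inj; rewrite toCX -!normCxE normrX. Qed.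

Lemma modCN z : modC (- z) = modC z.
Proof. by apply: toC_inj; rewrite -!normCxE normrN. Qed.

Lemma modCV z : modC (z^-1) = (modC z)^-1.
Proof. by apply: toC_inj; rewrite toCV -!normCxE normfV. Qed.

Lemma modC0 : modC (0 : Cx R) = 0.
Proof. by apply: toC_inj; rewrite -normCxE normr0. Qed.

Lemma modC_nat n : modC (n%:R : Cx R) = n%:R.
Proof. by apply: toC_inj; rewrite toC_nat -normCxE normr_nat. Qed.

Lemma modC1 : modC (1 : Cx R) = 1.
Proof. exact: (modC_nat 1). Qed.

Lemma modC_toC (x : R) : modC (toC x) = `|x|.
Proof.
apply: toC_inj; rewrite -normCxE; have [x0|/ltW x0] := leP 0 x.
  by rewrite !ger0_norm// -toC0 toC_le.
by rewrite !ler0_norm ?toCN// -toC0 toC_le.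
Qed.

Lemma modC_eq0 z : (modC z == 0) = (z == 0).
Proof. by rewrite -(inj_eq toC_inj) -normCxE normr_eq0. Qed.

Lemma modC_gt0 z : (0 < modC z) = (z != 0).
Proof. by rewrite -modC_eq0 lt0r modC_ge0 andbT. Qed.

Lemma modCD z w : modC (z + w) <= modC z + modC w.
Proof. by rewrite -toC_le toCD -!normCxE ler_normD. Qed.

Lemma modCB z w : modC (z - w) <= modC z + modC w.
Proof. by rewrite -toC_le toCD -!normCxE ler_normB. Qed.

Lemma modC_lowerD z w : modC z - modC w <= modC (z + w).
Proof. by rewrite -toC_le toCB -!normCxE lerB_normD. Qed.

Lemma modC_distC z w : modC (z - w) = modC (w - z).
Proof. by rewrite -modCN opprB. Qed.

Lemma modC_sum (I : Type) (r : seq I) (F : I -> Cx R) :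
  modC (\sum_(i <- r) F i) <= \sum_(i <- r) modC (F i).
Proof. by rewrite -toC_le toC_sum -normCxE; exact: ler_norm_sum. Qed.

Lemma ReCD z w : ReC (z + w) = ReC z + ReC w.
Proof. by case: z w => [a b] [c d]. Qed.

Lemma ReCN z : ReC (- z) = - ReC z.
Proof. by case: z. Qed.

Lemma ReCB z w : ReC (z - w) = ReC z - ReC w.
Proof. by rewrite ReCD ReCN. Qed.

Lemma ReC_toCM (x : R) z : ReC (toC x * z) = x * ReC z.
Proof. by case: z => [a b] /=; rewrite /ReC /= mul0r subr0. Qed.

Lemma ReC_sum (I : Type) (r : seq I) (F : I -> Cx R) :
  ReC (\sum_(i <- r) F i) = \sum_(i <- r) ReC (F i).
Proof. by apply: (big_morph _ ReCD). Qed.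

Definition ImC z : R := complex.Im z.

Lemma ImCD z w : ImC (z + w) = ImC z + ImC w.
Proof. by case: z w => [a b] [c d]. Qed.

Lemma ImCN z : ImC (- z) = - ImC z.
Proof. by case: z. Qed.

Lemma ImC_sum (I : Type) (r : seq I) (F : I -> Cx R) :
  ImC (\sum_(i <- r) F i) = \sum_(i <- r) ImC (F i).
Proof. by apply: (big_morph _ ImCD). Qed.

Lemma modC_ReIm z : modC z <= `|ReC z| + `|ImC z|.
Proof.
case: z => a b; rewrite /ReC /ImC /modC /= -[leRHS]ger0_norm ?addr_ge0//.
rewrite -sqrtr_sqr ler_wsqrtr// sqrrD !real_normK ?num_real// addrAC lerDl.
by rewrite mulrn_wge0// mulr_ge0.
Qed.

Lemma normr_ReC z : `|ReC z| <= modC z.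
Proof.
case: z => a b; rewrite /ReC /modC /= -sqrtr_sqr ler_wsqrtr// lerDl sqr_ge0//.
Qed.

Lemma normr_ImC z : `|ImC z| <= modC z.
Proof.
case: z => a b; rewrite /ImC /modC /= -sqrtr_sqr ler_wsqrtr// lerDr sqr_ge0//.
Qed.

(** The radii of the norm topology are positive elements of [Cx R], which are necessarily real. *)
Lemma cvgCxP T (F : set_system T) (FF : Filter F) (f : T -> Cx R) (l : Cx R) :
  f @ F --> l <-> forall e : R, 0 < e -> \forall x \near F, modC (l - f x) < e.
Proof.
split.
  move=> /cvgrPdist_lt h e e0; have := h (toC e); rewrite -toC0 toC_lt => /(_ e0).
  by apply: filterS => x; rewrite normCxE toC_lt.
move=> h; apply/cvgrPdist_lt => e e0.
have eE : e = toC (ReC e) by rewrite /toC RRe_real// gtr0_real.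
move: e0; rewrite eE -toC0 toC_lt => /h.
by apply: filterS => x; rewrite normCxE toC_lt.
Qed.

Lemma Cx_hausdorff : hausdorff_space (Cx R).
Proof. exact: norm_hausdorff. Qed.

Lemma cvg_ReC T (F : set_system T) (FF : Filter F) (f : T -> Cx R) (l : Cx R) :
  f @ F --> l -> (fun x => ReC (f x)) @ F --> ReC l.
Proof.
move=> /cvgCxP h; apply/cvgrPdist_lt => e /h; apply: filterS => x.
by rewrite -ReCB; apply: le_lt_trans; exact: normr_ReC.
Qed.

Lemma cvg_modC T (F : set_system T) (FF : Filter F) (f : T -> Cx R) (l : Cx R) :
  f @ F --> l -> (fun x => modC (f x)) @ F --> modC l.
Proof.
move=> /cvgCxP h; apply/cvgrPdist_lt => e /h; apply: filterS => x.
apply: le_lt_trans; rewrite ler_norml; apply/andP; split.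
  rewrite lerNl opprB lerBlDr (modC_distC l).
  by have := modCD (f x - l) l; rewrite subrK.
by rewrite lerBlDr; have := modCD (l - f x) (f x); rewrite subrK.
Qed.

Lemma cvg_toC T (F : set_system T) (FF : Filter F) (f : T -> R) (l : R) :
  f @ F --> l -> (fun x => toC (f x)) @ F --> toC l.
Proof.
move=> /cvgrPdist_lt h; apply/cvgCxP => e /h; apply: filterS => x.
by rewrite -toCB modC_toC.
Qed.

Lemma is_cvg_seriesC (u : nat -> Cx R) :
  cvgn (series (fun n => modC (u n))) -> cvgn (series u).
Proof.
move=> cu.
have cRe : cvgn (series (fun n => ReC (u n))).
  apply: normed_cvg; apply: (series_le_cvg _ _ _ cu) => n; rewrite ?modC_ge0//=; exact: normr_ReC.
have cIm : cvgn (series (fun n => ImC (u n))).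
  apply: normed_cvg; apply: (series_le_cvg _ _ _ cu) => n; rewrite ?modC_ge0//=; exact: normr_ImC.
apply/cvg_ex; exists ((limn (series (fun n => ReC (u n)))) +i* (limn (series (fun n => ImC (u n)))))%C.
apply/cvgCxP => e e0.
have e2 : 0 < e / 2 by rewrite divr_gt0.
move/cvgrPdist_lt: cRe => /(_ _ e2) h1; move/cvgrPdist_lt: cIm => /(_ _ e2) h2.
near=> n.
apply: (le_lt_trans (modC_ReIm _)); rewrite (splitr e) ltrD//.
  rewrite ReCB /series/= ReC_sum; near: n; exact: h1.
rewrite ImCD ImCN /series/= ImC_sum; near: n; exact: h2.
Unshelve. all: by end_near. Qed.

Lemma modC_series_le (u : nat -> Cx R) (v : nat -> R) (l : Cx R) (m : R) :
  (forall n, modC (u n) <= v n) -> series u @ \oo --> l -> series v @ \oo --> m ->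
  modC l <= m.
Proof.
move=> uv /cvg_modC ul vm; apply: ler_cvg_to ul vm _.
near=> n; apply: (le_trans (modC_sum _ _)); exact: ler_sum.
Unshelve. all: by end_near. Qed.
End ComplexModulus.

(** * Termwise differentiation of power series *)

Lemma cvg_seriesB (K : numFieldType) (u v : nat -> K) (l m : K) :
  series u @ \oo --> l -> series v @ \oo --> m ->
  series (fun n => u n - v n) @ \oo --> l - m.
Proof.
have -> : series (fun n => u n - v n) = (fun n => series u n - series v n).
  by apply/funext => n; rewrite /series/= sumrB.
exact: cvgB.
Qed.

Section PowerSeriesDerivative.
Context {R : realType}.
Implicit Types (f : Cx R -> Cx R) (a : nat -> Cx R) (z h : Cx R).

Lemma disc_toC (x : R) : `|x| < 1 -> disc (toC x).
Proof. by rewrite -modC_toC. Qed.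

(** Since [2 * bincoef 3 n = (n+1)(n+2)], the binomial series of exponent [-3] bounds the series of
    [(n+1)^2 x^n]. *)
Lemma sqrS_le_bincoef n : n.+1%:R ^+ 2 <= 2 * bincoef 3 n :> R.
Proof.
have bE : 2 * bincoef 3 n = n.+1%:R * n.+2%:R :> R.
  elim: n => [|n ih]; first by rewrite /bincoef poch0 fact0 divr1 mulr1 mul1r.
  rewrite bincoefS mulrA ih.
  by field; rewrite nat1r pnatr_eq0.
by rewrite bE expr2 ler_wpM2l// ler_nat.
Qed.

(** Convergence at some [r] between [rho] and 1 bounds [a_n r^n]. The factor [(n+1)^2] pays for the
    second-order remainder of the termwise derivative. *)
Lemma taylor_summable f a (rho : R) : taylor_on_disc f a -> 0 < rho -> rho < 1 ->
  cvgn (series (fun n => n.+1%:R ^+ 2 * modC (a n) * rho ^+ n)).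
Proof.
move=> fa r0 r1.
have [r [rr rl1 rp]] : exists r : R, [/\ rho < r, r < 1 & 0 < r].
  by exists ((1 + rho) / 2); split; lra.
have dr : disc (toC r) by apply: disc_toC; rewrite gtr0_norm.
have : (fun n => modC (a n * toC r ^+ n)) @ \oo --> modC (0 : Cx R).
  by apply: cvg_modC; apply: cvg_series_cvg_0; apply/cvg_ex; exists (f (toC r)); exact: fa.
move=> /cvgP /cvg_seq_bounded [K [_ hK]].
have {}hK n : modC (a n) * r ^+ n <= `|K| + 1.
  have K1 : K < `|K| + 1 by rewrite (le_lt_trans (ler_norm _))// ltrDl.
  have : `|modC (a n * toC r ^+ n)| <= `|K| + 1 by exact: hK.
  by rewrite ger0_norm ?modC_ge0// modCM modCX modC_toC (gtr0_norm rp).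
have x0 : 0 < rho / r by rewrite divr_gt0.
have x1 : rho / r < 1 by rewrite ltr_pdivrMr// mul1r.
have C := cvg_seriesMl (2 * (`|K| + 1)) (is_cvg_bincoef (ltr0n _ 3) x0 x1).
apply: (series_le_cvg _ _ _ (cvgP _ C)).
- by move=> n; rewrite !mulr_ge0 ?exprn_ge0 ?modC_ge0 ?(ltW r0).
- move=> n; apply: mulr_ge0; first by rewrite mulr_ge0// addr_ge0.
  by apply: mulr_ge0; [exact: ltW (bincoef_gt0 _ _)|exact: exprn_ge0 (ltW x0)].
- move=> n; have -> : 2 * (`|K| + 1) * (bincoef 3 n * (rho / r) ^+ n) =
      (2 * bincoef 3 n) * ((`|K| + 1) * (rho / r) ^+ n) by ring.
  have -> : n.+1%:R ^+ 2 * modC (a n) * rho ^+ n =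
     n.+1%:R ^+ 2 * ((modC (a n) * r ^+ n) * (rho / r) ^+ n).
    rewrite exprMn exprVn; field.
    by rewrite expf_neq0// gt_eqF.
  apply: ler_pM => //.
  - by rewrite !mulr_ge0 ?modC_ge0 ?exprn_ge0 ?(ltW rp) ?(ltW x0).
  - exact: sqrS_le_bincoef.
  - by rewrite ler_wpM2r// exprn_ge0// ltW.
Qed.

(* The factor [rho ^ 2] stands on the left because [n - 2] would be truncated. *)
Lemma second_difference_le z h (rho : R) n : 0 < rho ->
  modC z <= rho -> modC (h + z) <= rho ->
  modC ((h + z) ^+ n - z ^+ n - n%:R * z ^+ n.-1 * h) * rho ^+ 2 <=
  n%:R ^+ 2 * rho ^+ n * modC h ^+ 2.
Proof.
move=> r0 zr hzr; elim: n => [|n ih].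
  by rewrite !expr0 subrr !mul0r subr0 modC0 expr0n !mul0r.
(* The remainders satisfy [E_(n+1) = (h + z) E_n + n z^(n-1) h^2]; the bound then closes by
   [n^2 + n <= (n+1)^2]. *)
have -> : (h + z) ^+ n.+1 - z ^+ n.+1 - n.+1%:R * z ^+ n.+1.-1 * h =
   (h + z) * ((h + z) ^+ n - z ^+ n - n%:R * z ^+ n.-1 * h) + n%:R * z ^+ n.-1 * h ^+ 2.
  have zn : n%:R * z ^+ n = n%:R * z ^+ n.-1 * z.
    by case: n {ih} => [|n] /=; rewrite ?mul0r// [z ^+ n.+1]exprSr mulrA.
  rewrite /= -natr1 [(n%:R + 1) * _]mulrDl zn !exprS; ring.
have zn1 : modC (n%:R * z ^+ n.-1 * h ^+ 2) * rho ^+ 2 <= n%:R * rho ^+ n.+1 * modC h ^+ 2.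
  case: n {ih} => [|n] /=; first by rewrite !mul0r modC0 !mul0r.
  rewrite !modCM !modCX modC_nat.
  have -> : rho ^+ n.+2 = rho ^+ n * rho ^+ 2 by rewrite -exprD addn2.
  have : modC z ^+ n <= rho ^+ n by rewrite lerXn2r// nnegrE ?modC_ge0 ?(ltW r0).
  move=> h1; have := ler_wpM2r _ h1 => /(_ (n.+1%:R * modC h ^+ 2 * rho ^+ 2)).
  have -> : modC z ^+ n * (n.+1%:R * modC h ^+ 2 * rho ^+ 2) =
    n.+1%:R * modC z ^+ n * modC h ^+ 2 * rho ^+ 2 by ring.
  have -> : rho ^+ n * (n.+1%:R * modC h ^+ 2 * rho ^+ 2) =
    n.+1%:R * (rho ^+ n * rho ^+ 2) * modC h ^+ 2 by ring.
  by apply; rewrite !mulr_ge0 ?exprn_ge0 ?modC_ge0 ?(ltW r0).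
apply: (@le_trans _ _ (rho * (n%:R ^+ 2 * rho ^+ n * modC h ^+ 2) + n%:R * rho ^+ n.+1 * modC h ^+ 2)).
  apply: le_trans (_ : _ <= (modC (h + z) * modC ((h + z) ^+ n - z ^+ n - n%:R * z ^+ n.-1 * h)
     + modC (n%:R * z ^+ n.-1 * h ^+ 2)) * rho ^+ 2) _.
    by rewrite ler_wpM2r ?exprn_ge0 ?(ltW r0)// -modCM modCD.
  rewrite mulrDl -mulrA lerD//.
  by rewrite ler_pM ?modC_ge0// mulr_ge0 ?modC_ge0 ?exprn_ge0 ?(ltW r0).
have -> : rho * (n%:R ^+ 2 * rho ^+ n * modC h ^+ 2) + n%:R * rho ^+ n.+1 * modC h ^+ 2 =
  (n%:R ^+ 2 + n%:R) * (rho ^+ n.+1 * modC h ^+ 2) by rewrite (exprS rho); ring.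
rewrite -mulrA ler_wpM2r//; last first.
  rewrite -natr1; have : 0 <= n%:R :> R by []. nra.
by rewrite mulr_ge0 ?exprn_ge0 ?modC_ge0 ?(ltW r0).
Qed.

Lemma modC_le_open z (rho : R) : modC z < rho -> \forall h \near (0 : Cx R)^', modC (h + z) < rho.
Proof.
move=> zr; apply/nbhs_ballP; exists (toC (rho - modC z)).
  by rewrite /= -toC0 toC_lt subr_gt0.
move=> h; rewrite /ball /= sub0r normrN normCxE toC_lt => hh _.
by rewrite (le_lt_trans (modCD _ _))// -ltrBrDr.
Qed.

(** By [second_difference_le], the difference quotient is within [|h| rho^(-2) M] of [D], where [M]
    is the sum from [taylor_summable]. *)
Lemma taylor_derive1_cvg f a z : taylor_on_disc f a -> disc z ->
  exists2 D : Cx R, series (fun n => n%:R * a n * z ^+ n.-1) @ \oo --> D &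
    derive1 f z = D.
Proof.
move=> fa zd; have z0 := modC_ge0 z.
have zd1 : modC z < 1 by [].
have [rho [zr r1 r0]] : exists rho : R, [/\ modC z < rho, rho < 1 & 0 < rho].
  by exists ((1 + modC z) / 2); split; lra.
have /cvg_ex[M cs] := taylor_summable fa r0 r1.
have /cvg_ex[D cd] : cvgn (series (fun n => n%:R * a n * z ^+ n.-1)).
  apply: is_cvg_seriesC; apply: (series_le_cvg _ _ _ (cvgP _ (cvg_seriesMl (rho^-1) cs))).
  - by move=> n; exact: modC_ge0.
  - by move=> n; rewrite !mulr_ge0 ?invr_ge0 ?exprn_ge0 ?modC_ge0 ?(ltW r0).
  - case=> [|n]; first by rewrite !mul0r modC0 !mulr_ge0 ?invr_ge0 ?exprn_ge0 ?modC_ge0 ?(ltW r0).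
    rewrite !modCM modCX modC_nat /=.
    have -> : rho^-1 * (n.+2%:R ^+ 2 * modC (a n.+1) * rho ^+ n.+1) =
       n.+2%:R ^+ 2 * modC (a n.+1) * rho ^+ n by rewrite (exprS rho); field; rewrite gt_eqF.
    apply: ler_pM; rewrite ?mulr_ge0 ?modC_ge0 ?exprn_ge0//.
      rewrite ler_wpM2r ?modC_ge0// -(natr1 n.+1).
      have : 0 <= n.+1%:R :> R by []. nra.
    by rewrite lerXn2r// ?nnegrE ?modC_ge0 ?(ltW r0)// ltW.
exists D => //.
have M0 : 0 <= M.
  apply: le_trans (series_le_lim 0 _ cs); first by rewrite /series/= big_nil.
  by move=> n; rewrite !mulr_ge0 ?exprn_ge0 ?modC_ge0 ?(ltW r0).
have key h : h != 0 -> modC (h + z) < rho ->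
    modC (D - h^-1 * (f (h + z) - f z)) <= modC h * (rho ^- 2 * M).
  move=> h0 hz.
  have hzd : disc (h + z) by exact: lt_trans r1.
  have q1 : series (fun n => h^-1 * (a n * (h + z) ^+ n - a n * z ^+ n)) @ \oo -->
      h^-1 * (f (h + z) - f z).
    by apply: cvg_seriesMl; apply: cvg_seriesB; exact: fa.
  have q2 : series (fun n => n%:R * a n * z ^+ n.-1 -
      h^-1 * (a n * (h + z) ^+ n - a n * z ^+ n)) @ \oo --> D - h^-1 * (f (h + z) - f z).
    exact: cvg_seriesB cd q1.
  apply: (modC_series_le _ q2 (cvg_seriesMl (modC h) (cvg_seriesMl (rho ^- 2) cs))) => n.
  have -> : n%:R * a n * z ^+ n.-1 - h^-1 * (a n * (h + z) ^+ n - a n * z ^+ n) =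
     - (h^-1 * a n) * ((h + z) ^+ n - z ^+ n - n%:R * z ^+ n.-1 * h).
    by field.
  rewrite modCM modCN modCM modCV.
  have := second_difference_le n r0 (ltW zr) (ltW hz).
  have h0' : 0 < modC h by rewrite modC_gt0.
  rewrite -ler_pdivlMr ?exprn_gt0// => h1.
  apply: (@le_trans _ _ ((modC h)^-1 * modC (a n) * (n%:R ^+ 2 * rho ^+ n * modC h ^+ 2 / rho ^+ 2))).
    by rewrite ler_wpM2l// mulr_ge0 ?invr_ge0 ?modC_ge0.
  have -> : (modC h)^-1 * modC (a n) * (n%:R ^+ 2 * rho ^+ n * modC h ^+ 2 / rho ^+ 2) =
    modC h * (rho ^- 2 * (n%:R ^+ 2 * modC (a n) * rho ^+ n)).
    by field; rewrite !gt_eqF.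
  rewrite ler_wpM2l ?modC_ge0// ler_wpM2l ?invr_ge0 ?exprn_ge0 ?(ltW r0)//.
  rewrite ler_wpM2r ?exprn_ge0 ?(ltW r0)// ler_wpM2r ?modC_ge0// -natr1.
  have : 0 <= n%:R :> R by []. nra.
apply: cvg_lim; first exact: Cx_hausdorff.
apply/cvgCxP => e e0.
have C0 : 0 < rho ^- 2 * M + 1 by rewrite ltr_wpDl// mulr_ge0// invr_ge0 exprn_ge0// ltW.
have hh : \forall h \near (0 : Cx R)^', modC h < e / (rho ^- 2 * M + 1).
  have := @modC_le_open 0 (e / (rho ^- 2 * M + 1)); rewrite modC0 divr_gt0// => /(_ isT).
  by apply: filterS => h; rewrite addr0.
near=> h.
have h0 : h != 0 by near: h; exact: nbhs_dnbhs_neq.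
apply: (le_lt_trans (key h h0 _)); first by near: h; exact: modC_le_open.
have : modC h < e / (rho ^- 2 * M + 1) by near: h.
rewrite ltr_pdivlMr//; apply: le_lt_trans.
by rewrite ler_wpM2l ?modC_ge0// lerDl.
Unshelve. all: by end_near. Qed.

Lemma taylor_derive1 f a : taylor_on_disc f a ->
  taylor_on_disc (derive1 f) (fun n => n.+1%:R * a n.+1).
Proof.
move=> fa z zd; have [D sD ->] := taylor_derive1_cvg fa zd.
have -> : series (fun n => n.+1%:R * a n.+1 * z ^+ n) =
   (fun n => series (fun n => n%:R * a n * z ^+ n.-1) n.+1).
  by apply/funext => n; rewrite /series/= big_nat_recl//= !mul0r add0r.
by rewrite (cvg_shiftS (series _)).
Qed.

Lemma taylor_on_disc0 f a : taylor_on_disc f a -> f 0 = a 0%N.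
Proof.
move=> fa; have d0 : disc (0 : Cx R) by rewrite -toC0; apply: disc_toC; rewrite normr0.
apply: (cvg_unique Cx_hausdorff (fa 0 d0)); apply: cvg_near_cst; exists 1%N => //= n n0.
rewrite /series/= (big_cat_nat (n := 1))//= big_nat1 expr0 mulr1 big1_seq ?addr0//.
by move=> [|i]; rewrite mem_index_iota// => _; rewrite exprS mul0r mulr0.
Qed.

(** Coefficient [n + 1] of [f] is read off coefficient [n] of its derivative, hence the induction
    over all [f]. *)
Lemma taylor_unique f a b : taylor_on_disc f a -> taylor_on_disc f b -> a = b.
Proof.
move=> fa fb; apply/funext => n; elim: n f a b fa fb => [|n ih] f a b fa fb.
  by rewrite -(taylor_on_disc0 fa) -(taylor_on_disc0 fb).
have := ih _ _ _ (taylor_derive1 fa) (taylor_derive1 fb).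
by apply: mulfI; rewrite pnatr_eq0.
Qed.

Lemma taylor_coefE f a : taylor_on_disc f a -> taylor_coef f = a.
Proof.
move=> fa; apply: (taylor_unique _ fa).
by apply: (getPex (P := [set a | taylor_on_disc f a])); exists a.
Qed.

End PowerSeriesDerivative.

(** * A coefficient criterion for uniform convexity *)

Section UniformlyConvex.
Context {R : realType}.
Implicit Types (f g : Cx R -> Cx R) (A : nat -> Cx R) (z w : Cx R).

Lemma modC_subX_le z w n : modC z <= 1 -> modC w <= 1 ->
  modC (z ^+ n - w ^+ n) <= n%:R * modC (z - w).
Proof.
move=> z1 w1; elim: n => [|n ih]; first by rewrite subrr modC0 mul0r.
have -> : z ^+ n.+1 - w ^+ n.+1 = z * (z ^+ n - w ^+ n) + (z - w) * w ^+ n.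
  by rewrite !exprS; ring.
apply: (le_trans (modCD _ _)); rewrite !modCM modCX -natr1 mulrDl mul1r lerD//.
  apply: le_trans ih; rewrite ler_piMl ?modC_ge0//.
by rewrite ler_piMr ?modC_ge0// exprn_ile1 ?modC_ge0.
Qed.

(** The weight is [n (2n - 1)] at index [n + 2]. As it is at least [2n],
    [|g z - g w| >= |z - w| / 2], which gives univalence. As it equals [2 n (n-1) + n],
    [2 |g''| <= |g'|], and [|z - zeta| < 2] keeps the quotient below 1 in modulus. *)
Lemma classUCV_taylor g A : taylor_on_disc g A -> A 0%N = 0 -> A 1%N = 1 ->
  (forall N, \sum_(0 <= n < N) n.+2%:R * (2 * n + 3)%:R * modC (A n.+2) <= 1) ->
  classUCV g.
Proof.
move=> gA A0 A1 hA.
have d1 := taylor_derive1 gA; have d2 := taylor_derive1 d1.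
split; first split; first by exists A.
  move=> z w zd wd gzw; apply/eqP; rewrite -subr_eq0 -modC_eq0 eq_le modC_ge0 andbT.
  have c : series (fun n => A n * z ^+ n - A n * w ^+ n) @ \oo --> g z - g w.
    by apply: cvg_seriesB; exact: gA.
  have {c} : (fun n => modC (series (fun n => A n * z ^+ n - A n * w ^+ n) n)) @ \oo --> modC (g z - g w).
    exact: cvg_modC c.
  rewrite gzw subrr modC0 => c.
  suff : modC (z - w) / 2 <= 0 by rewrite ler_pdivrMr// mul0r.
  apply: (cvgn_ge_cst c (N := 2)) => -[|[|n]] // _.
  rewrite /series/= !big_nat_recl//= A0 A1 !mul0r subrr add0r !mul1r !expr1.
  apply: le_trans (modC_lowerD _ _).
  have h : modC (\sum_(0 <= i < n) (A i.+2 * z ^+ i.+2 - A i.+2 * w ^+ i.+2)) <=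
     2^-1 * modC (z - w).
    apply: (le_trans (modC_sum _ _)).
    apply: (@le_trans _ _ (\sum_(0 <= i < n) (2^-1 * (i.+2%:R * (2 * i + 3)%:R * modC (A i.+2))) * modC (z - w))).
      apply: ler_sum => i _; rewrite -mulrBr modCM.
      apply: (@le_trans _ _ (modC (A i.+2) * (i.+2%:R * modC (z - w)))).
        by rewrite ler_wpM2l ?modC_ge0// modC_subX_le// ltW.
      rewrite mulrA ler_wpM2r ?modC_ge0//.
      have -> : 2^-1 * (i.+2%:R * (2 * i + 3)%:R * modC (A i.+2)) =
        modC (A i.+2) * i.+2%:R * ((2 * i + 3)%:R / 2) by ring.
      rewrite ler_peMr ?mulr_ge0 ?modC_ge0// ler_pdivlMr// mul1r ler_nat.
      by rewrite addnC.
    rewrite -mulr_suml -mulr_sumr ler_wpM2r ?modC_ge0// ler_piMr//.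
  by rewrite lerBrDr; apply: (le_trans (lerD (lexx _) h)); lra.
move=> zeta z zetad zd.
set g1 := derive1 g z; set g2 := derive1 (derive1 g) z.
(* Otherwise [2 |g''| <= |g'|] forces [g' <> 0], so the quotient is a genuine one. *)
have [g20|g20] := eqVneq g2 0; first by rewrite g20 mulr0 mul0r addr0 ltr01.
have g21 : 2 * modC g2 <= modC g1.
  have c1 : (fun n => modC (series (fun n => n.+1%:R * A n.+1 * z ^+ n) n.+1)) @ \oo --> modC g1.
    rewrite (cvg_shiftS (fun n => modC (series (fun n => n.+1%:R * A n.+1 * z ^+ n) n))).
    by apply: cvg_modC; exact: d1.
  have c2 : (fun n => 2 * modC (series (fun n => n.+1%:R * (n.+2%:R * A n.+2) * z ^+ n) n)) @ \oo --> 2 * modC g2.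
    by apply: cvgMl_tmp; apply: cvg_modC; exact: d2.
  apply: ler_cvg_to c2 c1 _; near=> n.
  rewrite [in leRHS]/series/= big_nat_recl//= mul1r A1 expr0 mulr1.
  apply: le_trans (modC_lowerD _ _); rewrite modC1.
  have zi i : modC z ^+ i <= 1 by rewrite exprn_ile1 ?modC_ge0// ltW.
  have h1 : modC (\sum_(0 <= i < n) i.+2%:R * A i.+2 * z ^+ i.+1) <=
     \sum_(0 <= i < n) i.+2%:R * modC (A i.+2).
    apply: (le_trans (modC_sum _ _)); apply: ler_sum => i _.
    by rewrite !modCM modCX modC_nat ler_piMr ?mulr_ge0 ?modC_ge0.
  have h2 : modC (series (fun n => n.+1%:R * (n.+2%:R * A n.+2) * z ^+ n) n) <=
     \sum_(0 <= i < n) i.+1%:R * (i.+2%:R * modC (A i.+2)).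
    apply: (le_trans (modC_sum _ _)); apply: ler_sum => i _.
    by rewrite !modCM modCX !modC_nat ler_piMr ?mulr_ge0 ?modC_ge0.
  have : \sum_(0 <= i < n) i.+2%:R * (2 * i + 3)%:R * modC (A i.+2) =
     2 * \sum_(0 <= i < n) i.+1%:R * (i.+2%:R * modC (A i.+2)) +
     \sum_(0 <= i < n) i.+2%:R * modC (A i.+2).
    rewrite mulr_sumr -big_split/=; apply: eq_bigr => i _.
    by rewrite natrD natrM; ring.
  have := hA n; lra.
have g10 : 0 < modC g1.
  by apply: lt_le_trans g21; rewrite mulr_gt0// modC_gt0.
rewrite ReCD -[ReC 1]/(1 : R).
have v1 : modC ((z - zeta) * g2 / g1) < 1.
  rewrite !modCM modCV ltr_pdivrMr// mul1r; apply: lt_le_trans g21.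
  rewrite ltr_pM2r ?modC_gt0//; apply: (le_lt_trans (modCB _ _)).
  by have := ltrD (zd : modC z < 1) (zetad : modC zeta < 1).
have v2 : - ReC ((z - zeta) * g2 / g1) <= modC ((z - zeta) * g2 / g1).
  by rewrite (le_trans _ (normr_ReC _))// -normrN ler_norm.
by rewrite -ltrBlDl sub0r ltrNl (le_lt_trans v2).
Unshelve. all: by end_near. Qed.
End UniformlyConvex.

(** * Caratheodory's inequality *)

Lemma cvgn_subr (K : numFieldType) (u : nat -> K) (k l : K) :
  u @ \oo --> l -> (fun m => u m - k) @ \oo --> l - k.
Proof. by move=> ul; apply: cvgB => //; exact: cvg_cst. Qed.
Arguments cvgn_subr {K u} k {l}.

Section Caratheodory.
Context {R : realType}.
Implicit Types (P : Cx R -> Cx R) (c : nat -> Cx R) (z w : Cx R).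

(** Averages over roots of unity play the part of Cauchy integrals over circles. [X^n - 1] splits
    and, in characteristic 0, is separable, so it has [n] distinct roots. *)
Lemma prim_root_Cx n : (0 < n)%N -> exists w, n.-primitive_root w.
Proof.
move=> n0; have [rs Dp] := closed_field_poly_normal ('X^n - 1 : {poly Cx R}).
rewrite (monicP (monicXnsubC _ n0)) scale1r in Dp.
have rn1 : all n.-unity_root rs by apply/allP => z; rewrite -root_prod_XsubC -Dp.
have sz : (n < (size rs).+1)%N by rewrite -(size_prod_XsubC rs id) -Dp size_XnsubC.
have [|w _ hw] := hasP (cyclic.has_prim_root n0 rn1 _ sz); last by exists w.
by rewrite -separable.separable_prod_XsubC -Dp cyclotomic.separable_Xn_sub_1// pnatr_eq0 -lt0n.
Qed.

Lemma sum_prim_root w N m : N.-primitive_root w ->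
  \sum_(0 <= j < N) w ^+ (j * m) = if (N %| m)%N then N%:R else 0.
Proof.
move=> pw; rewrite (prim_order_dvd pw); case: eqP => [wm|/eqP wm].
  under eq_bigr do rewrite mulnC exprM wm expr1n.
  by rewrite sumr_const_nat subn0.
apply: (mulfI (_ : w ^+ m - 1 != 0)); first by rewrite subr_eq0.
rewrite mulr0.
have -> : (w ^+ m - 1) * \sum_(0 <= j < N) w ^+ (j * m) = (w ^+ m) ^+ N - 1.
  rewrite (subrX1 (w ^+ m) N) big_mkord; congr (_ * _); apply: eq_bigr => j _.
  by rewrite mulnC exprM.
by rewrite -exprM mulnC exprM (prim_expr_order pw) expr1n subrr.
Qed.

Lemma modC_prim_root w N : N.-primitive_root w -> modC w = 1.
Proof.
move=> pw; have N0 := prim_order_gt0 pw.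
have : modC w ^+ N == 1 by rewrite -modCX (prim_expr_order pw) modC1.
by rewrite pexpr_eq1 ?modC_ge0// => /eqP.
Qed.

Lemma conj_unit_modC w : modC w = 1 -> w^* = w^-1.
Proof.
move=> w1; have w0 : w != 0 by rewrite -modC_eq0 w1 oner_eq0.
by apply: (mulfI w0); rewrite divff// -normCK normCxE w1 toC1 expr1n.
Qed.

Lemma addC_conj z : z + z^* = toC (2 * ReC z).
Proof.
case: z => a b; apply/eqP; rewrite eq_complex /= /ReC /= subrr eqxx andbT mulrDl mul1r//.
Qed.

Lemma modC_conj z : modC z^* = modC z.
Proof. by apply: toC_inj; rewrite -!normCxE norm_conjC. Qed.

Lemma modC_tail_le (u : nat -> Cx R) (v : nat -> R) (l : Cx R) (M : R) n :
  (forall k, modC (u k) <= v k) -> series u @ \oo --> l -> series v @ \oo --> M ->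
  modC (l - series u n) <= M - series v n.
Proof.
move=> uv ul vM.
have c1 : (fun m => modC (series u m - series u n)) @ \oo --> modC (l - series u n).
  exact: cvg_modC (cvgn_subr (series u n) ul).
have c2 : (fun m => series v m - series v n) @ \oo --> M - series v n.
  exact: cvgn_subr.
apply: ler_cvg_to c1 c2 _; near=> m.
have nm : (n <= m)%N by near: m; exact: nbhs_infty_ge.
by rewrite !sub_series_geq// (le_trans (modC_sum _ _))// ler_sum.
Unshelve. all: by end_near. Qed.

Arguments modC_tail_le {u v l M} n.

(** Orthogonality keeps the [k] with [N] dividing [k + m]; as [0 < k + m < 2 N], only [k = N - m] is
    left. *)
Lemma prim_root_average c (r : R) w N m : N.-primitive_root w -> (m <= N)%N -> (0 < m)%N ->
  \sum_(0 <= j < N) (\sum_(0 <= k < N) c k * (toC r * w ^+ j) ^+ k) * w ^+ (j * m) =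
  N%:R * (c (N - m)%N * toC r ^+ (N - m)).
Proof.
move=> pw mN m0; have N0 := prim_order_gt0 pw.
have inner k : \sum_(0 <= j < N) c k * (toC r * w ^+ j) ^+ k * w ^+ (j * m) =
    c k * toC r ^+ k * (if (N %| k + m)%N then N%:R else 0).
  rewrite -(sum_prim_root (k + m) pw) mulr_sumr; apply: eq_bigr => j _.
  by rewrite exprMn -exprM mulnDr exprD; ring.
under eq_bigr do rewrite mulr_suml.
rewrite exchange_big_nat/= big_mkord.
under eq_bigr do rewrite inner.
have mN' : (N - m < N)%N by rewrite ltn_subrL m0.
rewrite (bigD1 (Ordinal mN'))//= big1 ?addr0.
  by rewrite subnK// dvdnn mulrC.
move=> [k kN] /= /eqP kne; case: ifP => [|_]; last by rewrite mulr0.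
move=> /dvdnP [q hq]; exfalso; apply: kne; apply: val_inj => /=.
case: q hq => [|[|q]]; rewrite ?mul0n ?mul1n => hq.
- by move/eqP: hq; rewrite addn_eq0 => /andP[_ /eqP m00]; rewrite m00 in m0.
- by rewrite -hq addnK.
- have : (k + m < N + N)%N by rewrite -addSn leq_add.
  by rewrite hq !mulSn addnA -[X in (_ < X)%N]addn0 ltn_add2l.
Qed.

Lemma prim_root_average0 c (r : R) w N : N.-primitive_root w ->
  \sum_(0 <= j < N) (\sum_(0 <= k < N) c k * (toC r * w ^+ j) ^+ k) = N%:R * c 0%N.
Proof.
move=> pw; have N0 := prim_order_gt0 pw.
have := prim_root_average c r pw (leqnn N) N0.
rewrite subnn expr0 mulr1 => <-; apply: eq_bigr => j _.
by rewrite mulnC exprM (prim_expr_order pw) expr1n mulr1.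
Qed.

(* Averaging the real parts at the N-th roots of unity against the character of
   index [n] only leaves the coefficients of index [n] and [N - n]. *)
Lemma caratheodory_partial c (r e : R) N n : 0 <= e -> (0 < n)%N -> (n < N)%N ->
  (forall z, modC z = `|r| -> - e <= ReC (\sum_(0 <= k < N) c k * z ^+ k)) ->
  modC (c n) * `|r| ^+ n <= 2 * ReC (c 0%N) + 4 * e + modC (c (N - n)%N) * `|r| ^+ (N - n).
Proof.
move=> e0 n0 nN hS; have N0 : (0 < N)%N by exact: leq_ltn_trans nN.
have NR : 0 < N%:R :> R by rewrite ltr0n.
have [w pw] := prim_root_Cx N0; have w1 := modC_prim_root pw.
pose S j := \sum_(0 <= k < N) c k * (toC r * w ^+ j) ^+ k.
have Sr j : - e <= ReC (S j) by apply: hS; rewrite modCM modCX w1 expr1n mulr1 modC_toC.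
have nN' : (0 < N - n)%N by rewrite subn_gt0.
have E1 := prim_root_average c r pw (leq_subr n N) nN'.
rewrite (subKn (ltnW nN)) in E1.
have E2 := prim_root_average c r pw (ltnW nN) n0.
have E0 := prim_root_average0 c r pw.
(* Write [2 Re S = S + S^*]. As [w^(j (N-n))] is the conjugate of [w^(j n)], the second half is the
   conjugate of [E2]. *)
have E3 : \sum_(0 <= j < N) (toC (2 * ReC (S j))) * w ^+ (j * (N - n)) =
    N%:R * (c n * toC r ^+ n + (c (N - n)%N * toC r ^+ (N - n))^*).
  rewrite mulrDr -E1 -[X in X * _^*]conjC_nat -rmorphM -E2 rmorph_sum -big_split/=.
  apply: eq_bigr => j _; rewrite -addC_conj mulrDl; congr (_ + _).
  rewrite rmorphM; congr (_ * _).
  have wu : modC (w ^+ (j * n)) = 1 by rewrite modCX w1 expr1n.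
  have wn0 : w ^+ (j * n) != 0 by rewrite -modC_eq0 wu oner_eq0.
  apply: (etrans _ (esym (conj_unit_modC wu))); apply: (mulfI wn0).
  by rewrite divff// -exprD -mulnDr subnKC ?(ltnW nN)// mulnC exprM (prim_expr_order pw) expr1n.
have h1 : N%:R * modC (c n * toC r ^+ n + (c (N - n)%N * toC r ^+ (N - n))^*) <=
    N%:R * (2 * ReC (c 0%N) + 4 * e).
  rewrite -[X in X * modC _](modC_nat (R := R)) -modCM -E3.
  apply: (le_trans (modC_sum _ _)).
  apply: (@le_trans _ _ (\sum_(0 <= j < N) (2 * ReC (S j) + 4 * e))).
    apply: ler_sum => j _; rewrite modCM modCX w1 expr1n mulr1 modC_toC normrM ger0_norm//.
    have := Sr j; move: (ReC (S j)) => x hx.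
    (* From [x >= - e]; doubling gives the [4 * e] of the statement. *)
    have : `|x| <= x + 2 * e by rewrite ler_norml; apply/andP; split; lra.
    lra.
  rewrite big_split/= -mulr_sumr -ReC_sum E0 sumr_const_nat subn0.
  by rewrite -toC_nat ReC_toCM -mulr_natl; lra.
rewrite ler_pM2l// in h1.
have := modC_lowerD (c n * toC r ^+ n) (c (N - n)%N * toC r ^+ (N - n))^*.
rewrite modC_conj !modCM !modCX modC_toC => h2.
by rewrite -lerBlDr; apply: le_trans h1.
Qed.

(** On a circle of radius [r < 1] a long partial sum has real part at least [- e / 5], and the stray
    coefficient of index [N - n] is negligible; then [r] tends to 1. *)
Lemma caratheodory P c n : taylor_on_disc P c ->
  (forall z, disc z -> 0 < ReC (P z)) -> (0 < n)%N -> modC (c n) <= 2 * ReC (c 0%N).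
Proof.
move=> Pc Ppos n0.
have key (r : R) : 0 < r -> r < 1 -> modC (c n) * r ^+ n <= 2 * ReC (c 0%N).
  move=> r0 r1; pose v k := modC (c k) * r ^+ k.
  have v0 k : 0 <= v k by rewrite mulr_ge0 ?modC_ge0 ?exprn_ge0 ?(ltW r0).
  have /cvg_ex[M vM] : cvgn (series v).
    apply: (series_le_cvg _ _ _ (taylor_summable Pc r0 r1)) => //.
    - by move=> k; rewrite !mulr_ge0 ?exprn_ge0 ?modC_ge0 ?(ltW r0).
    - move=> k; rewrite -mulrA ler_peMl ?v0// exprn_ege1// ler1n//.
  apply/ler_addgt0Pr => e e0.
  (* Four fifths go to the [4 * e] term of [caratheodory_partial], one to the coefficient of index
     [N - n]. *)
  have e5 : 0 < e / 5 by rewrite divr_gt0.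
  have hv : \forall k \near \oo, v k < e / 5.
    have /cvgrPdist_lt /(_ _ e5) := cvg_series_cvg_0 (cvgP _ vM).
    by apply: filterS => k; rewrite sub0r normrN ger0_norm.
  have hM : \forall k \near \oo, M - series v k < e / 5.
    move/cvgrPdist_lt: vM => /(_ _ e5); apply: filterS => k.
    by apply: le_lt_trans; exact: ler_norm.
  have [K _ hK] : \forall k \near \oo, v k < e / 5 /\ M - series v k < e / 5.
    by near=> k; split; near: k.
  (* With [N = K + 1 + n], both [N] and [N - n = K + 1] lie in the range where the estimates
     hold. *)
  have [vK _] := hK K.+1 (leqnSn K).
  have [_ MK] := hK (K.+1 + n)%N (leq_trans (leqnSn K) (leq_addr _ _)).
  have nN : (n < K.+1 + n)%N by rewrite addSn ltnS leq_addl.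
  have := @caratheodory_partial c r (e / 5) (K.+1 + n) n (ltW e5) n0 nN.
  rewrite (gtr0_norm r0) addnK => h.
  have : modC (c n) * r ^+ n <= 2 * ReC (c 0%N) + 4 * (e / 5) + v K.+1.
    apply: h => z zr; have zd : disc z by rewrite /disc; move: r1; rewrite -zr.
    have t1 : modC (P z - series (fun k => c k * z ^+ k) (K.+1 + n)) < e / 5.
      have uv k : modC (c k * z ^+ k) <= v k by rewrite modCM modCX zr.
      exact: le_lt_trans (modC_tail_le (K.+1 + n) uv (Pc z zd) vM) MK.
    have t2 := normr_ReC (P z - series (fun k => c k * z ^+ k) (K.+1 + n)).
    have t3 := le_lt_trans (le_trans (ler_norm _) t2) t1.
    move: t3; rewrite ReCB /series/=; have := Ppos z zd; lra.
  move: vK; lra.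
have c1 : (fun r : R => modC (c n) * r ^+ n) @ 1^'- --> modC (c n) * 1 ^+ n.
  by apply: cvgMl_tmp; apply: cvg_at_left_filter; exact: exprn_continuous.
rewrite expr1n mulr1 in c1.
apply: ler_cvg_to c1 (cvg_cst (2 * ReC (c 0%N))) _.
near=> r; apply: key; near: r; [exact: nbhs_left_gt|exact: nbhs_left_lt].
Unshelve. all: by end_near. Qed.
End Caratheodory.

(** * Coefficients of R(beta) and hypergeometric values *)

Section BoundedRotation.
Context {R : realType}.
Implicit Types (f : Cx R -> Cx R) (a c : nat -> Cx R) (z : Cx R).

Lemma modC_expi (phi : R) : modC (expi phi) = 1.
Proof. by rewrite /modC /expi /= cos2Dsin2 sqrtr1. Qed.

Lemma taylor_cst (k : Cx R) : taylor_on_disc (fun=> k) (fun n => if n is 0 then k else 0).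
Proof.
move=> z _; apply: cvg_near_cst; exists 1%N => //= n n0.
rewrite /series/= (big_cat_nat (n := 1))//= big_nat1 expr0 mulr1 big1_seq ?addr0//.
by move=> [|i]; rewrite mem_index_iota// => _; rewrite mul0r.
Qed.

(** Caratheodory for [e^(i phi) (f' - beta)], whose constant term has real part
    [(1 - beta) cos phi <= 1 - beta]. *)
Lemma classR_coef_le (beta : R) f a n : beta < 1 -> classR beta f ->
  taylor_on_disc f a -> a 1%N = 1 -> (0 < n)%N ->
  n.+1%:R * modC (a n.+1) <= 2 * (1 - beta).
Proof.
move=> b1 [_ [phi hphi]] fa a1 n0.
pose c k := expi phi * (k.+1%:R * a k.+1 - (if k is 0 then toC beta else 0)).
have Pc : taylor_on_disc (fun z => expi phi * (derive1 f z - toC beta)) c.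
  move=> z zd; have h1 := taylor_derive1 fa zd.
  have h2 := taylor_cst (k := toC beta) zd.
  have := cvg_seriesMl (expi phi) (cvg_seriesB h1 h2).
  by apply: eq_cvg_series => k; rewrite -mulrBl mulrA.
have := caratheodory Pc hphi n0.
case: n n0 => // n _; rewrite /c subr0 mul1r a1 modCM modC_expi mul1r modCM modC_nat => h.
apply: (le_trans h).
have -> : expi phi * (1 - toC beta) = toC (1 - beta) * expi phi.
  by rewrite toCB toC1 mulrC.
rewrite ReC_toCM ler_pM2l// ler_piMr ?subr_ge0 ?(ltW b1)//.
exact: cos_le1.
Qed.
End BoundedRotation.

(** * Multiplication formula for Pochhammer symbols *)

Section Quadruplication.
Variable F : numFieldType.

(** The four symbols collect the factors of [(x)_(4n)] by residue modulo 4. The powers of 4 cancel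
    between the [b] and [c] parameters of the 5F4. *)
Lemma poch_quadruple (x : F) n :
  poch (x / 4%:R) n * poch ((x + 1) / 4%:R) n * poch ((x + 2%:R) / 4%:R) n *
    poch ((x + 3%:R) / 4%:R) n * 4%:R ^+ (4 * n) = poch x (4 * n).
Proof.
elim: n => [|n ih]; first by rewrite muln0 !poch0 expr0 !mulr1.
have -> : (4 * n.+1 = 4 * n + 4)%N by rewrite mulnS addnC.
rewrite pochD -ih exprD.
have -> y : poch y 4 = y * (y + 1) * (y + 2%:R) * (y + 3%:R) :> F.
  by rewrite !pochS poch0 mul1r addr0.
rewrite natrM !(pochS _ n).
move: (4%:R ^+ (4 * n)) (poch _ n) (poch _ n) (poch _ n) (poch _ n) => E A B C D.
by field.
Qed.
End Quadruplication.

(** * Pochhammer estimates, and 2F1 at -1 as an Abel limit *)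

Section HypergeometricCoefficients.
Context {R : realType}.

Lemma toC_poch (x : R) n : toC (poch x n) = poch (toC x) n.
Proof.
elim: n => [|n ih]; first by rewrite !poch0.
by rewrite !pochS toCM ih toCD toC_nat.
Qed.

Lemma modC_poch (x : Cx R) n : modC (poch x n) <= poch (modC x) n.
Proof.
elim: n => [|n ih]; first by rewrite !poch0 modC1.
rewrite !pochS modCM ler_pM ?modC_ge0//.
by rewrite (le_trans (modCD _ _))// modC_nat.
Qed.

Lemma poch1 n : poch (1 : Cx R) n = n`!%:R.
Proof.
elim: n => [|n ih]; first by rewrite poch0.
by rewrite pochS ih factS natrM mulrC nat1r.
Qed.

Lemma le_poch (x y : R) n : 0 < x -> x <= y -> poch x n <= poch y n.
Proof.
move=> x0 xy; elim: n => [|n ih]; first by rewrite !poch0.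
by rewrite !pochS ler_pM ?(ltW (poch_gt0 _ x0)) ?addr_ge0 ?(ltW x0) ?lerD2r.
Qed.

Lemma poch_ratio_le1 (x y : R) n : 0 < x -> x <= y -> poch x n / poch y n <= 1.
Proof.
move=> x0 xy; have y0 := lt_le_trans x0 xy.
by rewrite ler_pdivrMr ?poch_gt0// mul1r le_poch.
Qed.

(** The continuation is continuous at [-1], so its value there is the limit of the sums at [-x],
    even where the series at [-1] diverges. [q <= r] bounds the coefficients by those of the
    binomial series. *)
Lemma hyp2F1_abel (p q r F : R) : 0 < p -> 0 < q -> q <= r ->
  is_hyp2F1 (toC p) (toC q) (toC r) (- 1) (toC F) ->
  exists H : R -> R,
    (forall x : R, 0 < x -> x < 1 ->
      series (fun k => poch p k * poch q k / (poch r k * k`!%:R) * (- x) ^+ k)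
        @ \oo --> H x) /\
    H x @[x --> 1^'-] --> F.
Proof.
move=> p0 q0 qr [_ [G [dG GE GF]]]; have r0 := lt_le_trans q0 qr.
pose t (x : R) k := poch p k * poch q k / (poch r k * k`!%:R) * (- x) ^+ k.
have cH (x : R) : 0 < x -> x < 1 -> cvgn (series (t x)).
  move=> x0 x1; apply: normed_cvg.
  apply: (series_le_cvg _ _ _ (is_cvg_bincoef p0 x0 x1)) => k //=.
    exact: mulr_ge0 (ltW (bincoef_gt0 _ p0)) (exprn_ge0 _ (ltW x0)).
  rewrite /t normrM normrX normrN (gtr0_norm x0).
  have -> : poch p k * poch q k / (poch r k * k`!%:R) = bincoef p k * (poch q k / poch r k).
    by rewrite /bincoef invfM; ring.
  rewrite normrM !gtr0_norm ?divr_gt0 ?poch_gt0 ?bincoef_gt0//.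
  apply: ler_wpM2r; first exact: exprn_ge0 (ltW x0).
  by apply: ler_piMr (poch_ratio_le1 _ q0 qr); exact: ltW (bincoef_gt0 _ _).
exists (fun x => limn (series (t x))); split; first exact: cH.
have GH (x : R) : 0 < x -> x < 1 -> G (toC (- x)) = toC (limn (series (t x))).
  move=> x0 x1.
  rewrite GE; last by apply: disc_toC; rewrite normrN gtr0_norm.
  apply: (cvg_lim Cx_hausdorff).
  have -> : series (fun n => \prod_(u <- [:: toC p; toC q]) poch u n /
     (\prod_(l <- [:: toC r]) poch l n * poch 1 n) * toC (- x) ^+ n) =
     (fun n => toC (series (t x) n)).
    apply/funext => n; rewrite /series/= toC_sum; apply: eq_bigr => k _.
    rewrite !big_cons !big_nil !mulr1 poch1.
    by rewrite /t !toCM toCV toCX toCM toC_nat !toC_poch.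
  by apply: cvg_toC; exact: cH.
have m1 : (- 1 : Cx R) = toC (- 1) by rewrite toCN.
have sm1 : slit_plane (- 1 : Cx R).
  move=> s s1; rewrite m1 => /toC_inj h; move: s1; rewrite -h.
  by apply/negP; rewrite -ltNge; lra.
have /derivable1_diffP /differentiable_continuous cG := dG _ sm1.
have c1 : G (toC (- x)) @[x --> (1 : R)^'-] --> G (- 1).
  have h : (fun x : R => - x) @ (1 : R)^'- --> (- 1 : R).
    by apply: cvgN; apply: cvg_at_left_filter; exact: cvg_id.
  have l1 : (fun x : R => toC (- x)) @ (1 : R)^'- --> (- 1 : Cx R).
    by rewrite m1; exact: cvg_toC h.
  exact: (cvg_comp (fun x : R => toC (- x)) G l1 cG).
have c2 : toC (limn (series (t x))) @[x --> (1 : R)^'-] --> toC F.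
  rewrite -GF; apply: cvg_trans c1; apply: near_eq_cvg; near=> x.
  by rewrite GH.
exact: (cvg_ReC _ c2).
Unshelve. all: by end_near. Qed.
End HypergeometricCoefficients.

(** * The operator *)

Section OperatorCoefficients.
Context {R : realType}.
Variables (a b : Cx R) (c : R).
Hypotheses (a0 : a != 0) (b0 : b != 0) (hc : modC a + modC b + 1 < c).
Local Notation al := (modC a).
Local Notation B := (modC b).

Let al0 : 0 < al. Proof. by rewrite modC_gt0. Qed.
Let B0 : 0 < B. Proof. by rewrite modC_gt0. Qed.
Let c0 : 0 < c. Proof. by apply: lt_trans hc; rewrite !addr_gt0. Qed.
Let Bc : B <= c. Proof.
by apply: ltW; apply: le_lt_trans hc; rewrite addrAC lerDr addr_ge0 ?modC_ge0.
Qed.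

Let us := [:: a; b / 4%:R; (b + 1) / 4%:R; (b + 2%:R) / 4%:R; (b + 3%:R) / 4%:R].
Let ls := [:: toC (c / 4%:R); toC ((c + 1) / 4%:R); toC ((c + 2%:R) / 4%:R);
           toC ((c + 3%:R) / 4%:R)].

Definition opI_weight k : R := bincoef al k * (poch B (4 * k) / poch c (4 * k)).

Let T k : Cx R := (\prod_(u <- us) poch u k) / ((\prod_(l <- ls) poch l k) * poch 1 k).

Let TE k : T k = poch a k * (poch b (4 * k) / toC (poch c (4 * k))) / k`!%:R.
Proof.
have e4 : (4%:R : Cx R) ^+ (4 * k) != 0 by rewrite expf_neq0// pnatr_eq0.
rewrite /T /us /ls !big_cons !big_nil !mulr1 poch1 toC_poch.
rewrite -(poch_quadruple b) -(poch_quadruple (toC c)).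
have t4 (x : R) : toC (x / 4%:R) = toC x / 4%:R by rewrite toCM toCV toC_nat.
rewrite !t4 (toCD c 1) (toCD c 2%:R) (toCD c 3%:R) !toC_nat toC1.
move: e4; move: (4%:R ^+ (4 * k)) (poch a k) => E P e4.
rewrite !invfM.
move: (poch (b / _) k) (poch ((b + 1) / _) k) (poch ((b + 2%:R) / _) k) (poch ((b + 3%:R) / _) k) => P1 P2 P3 P4.
move: (poch (toC c / _) k)^-1 (poch ((toC c + 1) / _) k)^-1 (poch ((toC c + 2%:R) / _) k)^-1 (poch ((toC c + 3%:R) / _) k)^-1 => Q1 Q2 Q3 Q4.
by field; rewrite e4 fact_neq0.
Qed.

Let T0 : T 0 = 1.
Proof. by rewrite TE muln0 !poch0 fact0 toC1 !divr1 mulr1. Qed.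

Lemma opI_weight_gt0 k : 0 < opI_weight k.
Proof. by rewrite mulr_gt0 ?bincoef_gt0// divr_gt0 ?poch_gt0. Qed.

Let T_le k : modC (T k) <= opI_weight k.
Proof.
rewrite TE /opI_weight /bincoef !modCM !modCV modC_nat modC_toC (gtr0_norm (poch_gt0 _ c0)).
rewrite [leRHS]mulrAC ler_wpM2r ?invr_ge0//.
apply: ler_pM; rewrite ?mulr_ge0 ?modC_ge0 ?invr_ge0 ?(ltW (poch_gt0 _ c0)) ?modC_poch//.
by rewrite ler_wpM2r ?modC_poch// invr_ge0 ltW// poch_gt0.
Qed.

Let U n : Cx R := if n is k.+1 then T k else 0.

Let U_taylor : taylor_on_disc (fun z => z * hypser us ls z) U.
Proof.
move=> z zd; have z0 := modC_ge0 z; have z1 : modC z < 1 by [].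
have [rho [zr r1 r0]] : exists rho : R, [/\ modC z < rho, rho < 1 & 0 < rho].
  by exists ((1 + modC z) / 2); split; lra.
have cT : cvgn (series (fun k => T k * z ^+ k)).
  apply: is_cvg_seriesC; apply: (series_le_cvg _ _ _ (is_cvg_bincoef al0 r0 r1)) => k.
  - exact: modC_ge0.
  - exact: mulr_ge0 (ltW (bincoef_gt0 _ al0)) (exprn_ge0 _ (ltW r0)).
  - rewrite modCM modCX; apply: ler_pM; rewrite ?modC_ge0 ?exprn_ge0//.
      apply: (le_trans (T_le k)); apply: ler_piMr (poch_ratio_le1 _ B0 Bc).
      exact: ltW (bincoef_gt0 _ al0).
    by rewrite lerXn2r// ?nnegrE ?(ltW r0)// ltW.
have h := cvg_seriesMl z cT.
rewrite -(cvg_shiftS (series _)).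
have -> : (fun n => series (fun n => U n * z ^+ n) n.+1) = series (fun n => z * (T n * z ^+ n)).
  apply/funext => n; rewrite /series/= big_nat_recl//= mul0r add0r.
  by apply: eq_bigr => k _; rewrite exprS mulrCA.
exact: h.
Qed.

(** The bounds on the kernel and on [f] reduce the criterion to [2 (1 - beta)] times the sum of
    [(2k + 1) t_k] over [k >= 1]; the term [k = 0] equals 1 and accounts for the [+ 1] of the
    hypothesis. *)
Lemma opI_classUCV (beta : R) f : 0 <= beta -> beta < 1 -> classR beta f ->
  (forall N, \sum_(0 <= n < N) (2 * n + 1)%:R * opI_weight n <= 1 / (2 * (1 - beta)) + 1) ->
  classUCV (opI a b c f).
Proof.
move=> be0 be1 fR hw; have [[aa [aa0 aa1 fa]] _] := fR.
have hb n : (0 < n)%N -> n.+1%:R * modC (aa n.+1) <= 2 * (1 - beta).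
  exact: classR_coef_le be1 fR fa aa1.
pose A n := U n * aa n.
have opE z : opI a b c f z = limn (series (fun n => A n * z ^+ n)).
  by rewrite /opI /hadamard (taylor_coefE U_taylor) (taylor_coefE fa).
(* Uses [beta >= 0]. Bounded coefficients make the Hadamard product converge on the whole disc. *)
have aa_le n : modC (aa n) <= 2.
  case: n => [|[|n]]; first by rewrite aa0 modC0.
    by rewrite aa1 modC1 ler1n.
  apply: (@le_trans _ _ (n.+2%:R * modC (aa n.+2))).
    by rewrite ler_peMl ?modC_ge0// ler1n.
  by apply: (le_trans (hb n.+1 isT)); lra.
have gA : taylor_on_disc (opI a b c f) A.
  move=> z zd; rewrite opE; have z0 := modC_ge0 z; have z1 : modC z < 1 by [].
  have [rho [zr r1 r0]] : exists rho : R, [/\ modC z < rho, rho < 1 & 0 < rho].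
    by exists ((1 + modC z) / 2); split; lra.
  have /cvg_ex[l hl] := taylor_summable U_taylor r0 r1.
  apply: is_cvg_seriesC; apply: (series_le_cvg _ _ _ (cvgP _ (cvg_seriesMl 2 hl))) => n.
  - exact: modC_ge0.
  - by rewrite !mulr_ge0 ?exprn_ge0 ?modC_ge0 ?(ltW r0).
  - rewrite modCM modCX /A modCM.
    have -> : 2 * (n.+1%:R ^+ 2 * modC (U n) * rho ^+ n) =
      (n.+1%:R ^+ 2 * (modC (U n) * 2)) * rho ^+ n by ring.
    apply: ler_pM; rewrite ?mulr_ge0 ?modC_ge0 ?exprn_ge0//; last first.
      by rewrite lerXn2r// ?nnegrE ?(ltW r0)// ltW.
    apply: (@le_trans _ _ (modC (U n) * 2)); first by rewrite ler_wpM2l ?modC_ge0.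
    by rewrite ler_peMl ?mulr_ge0 ?modC_ge0// exprn_ege1// ler1n.
apply: (classUCV_taylor gA); rewrite /A.
- by rewrite aa0 mulr0.
- by rewrite /U T0 aa1 mulr1.
(* Coefficient [n + 2] of the image comes from index [k = n + 1] of the kernel, and
   [2k + 1 = 2n + 3]. *)
- move=> N; apply: (@le_trans _ _ (\sum_(0 <= n < N) 2 * (1 - beta) * ((2 * n.+1 + 1)%:R * opI_weight n.+1))).
    apply: ler_sum => n _; rewrite modCM /=.
    have -> : n.+2%:R * (2 * n + 3)%:R * (modC (T n.+1) * modC (aa n.+2)) =
      (n.+2%:R * modC (aa n.+2)) * ((2 * n + 3)%:R * modC (T n.+1)) by ring.
    have -> : (2 * n.+1 + 1 = 2 * n + 3)%N by rewrite mulnS addnAC addnC addnA.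
    apply: ler_pM; rewrite ?mulr_ge0 ?modC_ge0 ?hb//.
    by rewrite ler_wpM2l// T_le.
  rewrite -mulr_sumr; have := hw N.+1; rewrite big_nat_recl//=.
  have -> : opI_weight 0 = 1.
    by rewrite /opI_weight /bincoef muln0 !poch0 fact0 !divr1 mulr1.
  rewrite mulr1 muln0 add0n addrC lerD2r => h.
  have b2 : 0 < 2 * (1 - beta) by lra.
  by move: h; rewrite ler_pdivlMr// mulrC.
Qed.
End OperatorCoefficients.

(** * Splitting the weight [2k + 1] and collecting the Gamma factors *)

Theorem theorem3p28 (R : realType) (a b : Cx R) (c beta : R)
    (F1 F2 : nat -> R) (S1 S2 : R)
    (ha : a != 0) (hb : b != 0)
    (hc0 : 0 < c) (hc : modC a + modC b + 1 < c)
    (hbeta : 0 <= beta < 1)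
    (hF1 : forall n : nat,
       is_hyp2F1 (toC (modC a + 1)) (toC (modC b + 4%:R + (2 * n)%:R))
         (toC (c - modC a + 3%:R + (2 * n)%:R)) (- 1) (toC (F1 n)))
    (hF2 : forall n : nat,
       is_hyp2F1 (toC (modC a)) (toC (modC b + (2 * n)%:R))
         (toC (c - modC a + (2 * n)%:R)) (- 1) (toC (F2 n)))
    (hS1 : series (fun n : nat =>
         gbinom (- (modC a + 1)) n
         * (Gamma (modC b + 4%:R + (2 * n)%:R)
            / Gamma (c - modC a + 3%:R + (2 * n)%:R))
         * F1 n) @ \oo --> S1)
    (hS2 : series (fun n : nat =>
         gbinom (- modC a) n
         * (Gamma (modC b + (2 * n)%:R) / Gamma (c - modC a + (2 * n)%:R))
         * F2 n) @ \oo --> S2)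
    (hineq :
       Gamma c * Gamma (c - modC a - modC b)
         / (Gamma (modC b) * Gamma (c - modC b))
         * (2%:R * modC a / (c - modC a - modC b - 1) * S1 + S2)
       <= 1 / (2%:R * (1 - beta)) + 1) :
  forall f : Cx R -> Cx R, classR beta f -> classUCV (opI a b c f).
Proof.
move=> f fR; case/andP: hbeta => be0 be1.
set al := modC a in hc hF1 hF2 hS1 hS2 hineq *; set B := modC b in hc hF1 hF2 hS1 hS2 hineq *.
have al0 : 0 < al by rewrite modC_gt0.
have B0 : 0 < B by rewrite modC_gt0.
apply: (opI_classUCV ha hb hc be0 be1 fR) => N; apply: le_trans hineq.
pose s := c - al - B; pose s1 := c - al - B - 1.
have s10 : 0 < s1 by rewrite /s1; move: hc; rewrite -subr_gt0; congr (0 < _); ring.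
have sE : s = s1 + 1 by rewrite /s1 subrK.
have s0 : 0 < s by rewrite sE addr_gt0.
have al10 : 0 < al + 1 by rewrite addr_gt0.
have B40 : 0 < B + 4%:R by rewrite addr_gt0.
have cBE : s + al = c - B by rewrite /s; ring.
have cB0 : 0 < c - B by rewrite -cBE addr_gt0.
have w2 : \sum_(0 <= n < N) opI_weight a b c n <=
    Gamma c * Gamma s / (Gamma B * Gamma (c - B)) * S2.
  have e1 : B + s + al = c by rewrite /s; ring.
  have e3 n : c - al + (2 * n)%:R = B + s + (2 * n)%:R by rewrite /s; ring.
  have := @hypergeometric_sum_le R al B s al0 B0 s0 F2 S2 N.
  rewrite e1 cBE; apply.
    move=> n; apply: hyp2F1_abel => //; last by rewrite -e3; exact: hF2.
      by rewrite ltr_wpDr.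
    by rewrite lerD2r lerDl ltW.
  by move: hS2; apply: eq_cvg_series => n; rewrite e3.
(* By [bincoef_recl], [n t_n] is [al (B)_4 / (c)_4] times the term of index [n - 1] for [al + 1],
   [B + 4], [c + 4], where [s] becomes [s1 = s - 1]. *)
have w1 : \sum_(0 <= n < N) n%:R * opI_weight a b c n <=
    al / s1 * (Gamma c * Gamma s / (Gamma B * Gamma (c - B))) * S1.
  have e1 : B + 4%:R + s1 + (al + 1) = c + 4%:R by rewrite /s1; ring.
  have e2 : s1 + (al + 1) = c - B by rewrite /s1; ring.
  have e3 n : c - al + 3%:R + (2 * n)%:R = B + 4%:R + s1 + (2 * n)%:R by rewrite /s1; ring.
  have h : \sum_(0 <= k < N) bincoef (al + 1) k * (poch (B + 4%:R) (4 * k) / poch (c + 4%:R) (4 * k)) <=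
      Gamma (c + 4%:R) * Gamma s1 / (Gamma (B + 4%:R) * Gamma (c - B)) * S1.
    have := @hypergeometric_sum_le R (al + 1) (B + 4%:R) s1 al10 B40 s10 F1 S1 N.
    rewrite e1 e2; apply.
      move=> n; apply: hyp2F1_abel => //; last by rewrite -e3; exact: hF1.
        by rewrite ltr_wpDr.
      by rewrite lerD2r lerDl ltW.
    by move: hS1; apply: eq_cvg_series => n; rewrite e3.
  (* One nonnegative term is added so that, once the zero term at [n = 0] is dropped, exactly [N]
     shifted terms remain. *)
  apply: (@le_trans _ _ (\sum_(0 <= n < N.+1) n%:R * opI_weight a b c n)).
    by rewrite big_nat_recr//= lerDl mulr_ge0// ltW// opI_weight_gt0.
  rewrite big_nat_recl//= mul0r add0r.
  have pB := poch_gt0 4 B0; have pc := poch_gt0 4 hc0.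
  have -> : \sum_(0 <= n < N) n.+1%:R * opI_weight a b c n.+1 = al * (poch B 4 / poch c 4) *
    \sum_(0 <= k < N) bincoef (al + 1) k * (poch (B + 4%:R) (4 * k) / poch (c + 4%:R) (4 * k)).
    rewrite mulr_sumr; apply: eq_bigr => n _.
    rewrite /opI_weight -/al -/B mulrA bincoef_recl mulnS (pochD B 4) (pochD c 4) invfM.
    move: (bincoef _ n) (poch (B + _) (4 * n)) (poch (c + _) (4 * n)) => X Y Z; ring.
  apply: (le_trans (ler_wpM2l _ h)); first by rewrite mulr_ge0 ?divr_ge0 ?ltW.
  (* [Gamma (c + 4) / Gamma (B + 4)] absorbs [(B)_4 / (c)_4], and [Gamma s = s1 * Gamma s1] is the
     origin of the denominator [c - |a| - |b| - 1]. *)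
  rewrite (Gamma_poch 4 hc0) (Gamma_poch 4 B0) sE (Gamma_rec s10).
  have G1 := Gamma_gt0 B0; have G2 := Gamma_gt0 cB0.
  move: (Gamma c) (Gamma s1) (Gamma B) (Gamma (c - B)) (poch B 4) (poch c 4) pB pc G1 G2
    => X Y Z W P Q pB pc G1 G2.
  rewrite le_eqVlt; apply/orP; left; apply/eqP; field.
  by rewrite !gt_eqF.
have -> : \sum_(0 <= n < N) (2 * n + 1)%:R * opI_weight a b c n =
    2 * (\sum_(0 <= n < N) n%:R * opI_weight a b c n) + \sum_(0 <= n < N) opI_weight a b c n.
  rewrite mulr_sumr -big_split/=; apply: eq_bigr => n _.
  by rewrite natrD natrM; ring.
have {}w1 := ler_wpM2l (ler0n _ 2) w1.
apply: (le_trans (lerD w1 w2)); rewrite -/s -/s1.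
move: (Gamma c) (Gamma s) (Gamma B) (Gamma (c - B)) => X Y Z W.
by rewrite le_eqVlt; apply/orP; left; apply/eqP; ring.
Qed.
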